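(* Let $\epsilon\in(0,1)$. With no information about $p_{\max}$ given, Algorithm 3 (described in the context) is a one-pass $(1+\epsilon)$-approximation streaming algorithm for $P_m\mid \text{stream, share},\ e_{i,k}\ge e_0 \text{ for } i\le m_1\mid C_{\max}$ which takes $O(1)$ time to process each job in the stream, uses $O\big(\tilde n+\frac{m^2}{\epsilon e_0 m_1}\log\frac{m}{\epsilon e_0}\big)$ space, and $O\big(\tilde n+t_1(m,m_1,\tilde n,\epsilon,e_0)\big)$ time to output an approximation of $C^*_{\max}$ within a factor $1+\epsilon$, where $$t_1(m,m_1,\tilde n,\epsilon,e_0)= m^{O\left(\frac{m^2}{\epsilon e_0 m_1}\log\frac{m}{\epsilon e_0 m_1}\right)}\cdot\log\!\Big(\tfrac1\epsilon\log\tfrac{m}{e_0}\Big)\cdot\sum_{i=1}^m\log k_i .$$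
   Context: Problem: $m$ identical parallel machines $M_1,\dots,M_m$ ($m$ a constant) and $n$ primary jobs with processing times $p_1,\dots,p_n>0$, all available at time $0$. The time axis of each machine $M_i$ is partitioned into consecutive intervals $(0,t_{i,1}],(t_{i,1},t_{i,2}],\dots$ (sorted) with sharing ratios $e_{i,1},e_{i,2},\dots\in(0,1]$; in an interval with ratio $e$ the machine processes primary jobs at rate $e$. Machine $M_i$ has $k_i$ shared intervals ($O(k_i)$ intervals in total), $\tilde n=\sum_i k_i$. Integers $1\le m_1\le m-1$ and a constant $e_0\in(0,1]$ are given with $e_{i,k}\ge e_0$ for all intervals of $M_1,\dots,M_{m_1}$. Each job is processed on one machine without interruption, one job at a time per machine. Objective: minimize the makespan; $C^*_{\max}$ is the optimum. $A_i(t)$ is the processing available on $M_i$ in $(0,t]$ ($A_i(t)=t e_{i,1}$ on $(0,t_{i,1}]$, $A_i(t)=A_i(t_{i,k})+(t-t_{i,k})e_{i,k+1}$ on $(t_{i,k},t_{i,k+1}]$), $A(t)=\sum_iA_i(t)$. Streaming model (''stream''): the machine data and parameters are known in advance; the processing times arrive one by one as a stream whose length is unknown in advance; a pass reads the stream once in order with limited memory. ''Approximation within a factor $1+\epsilon$'': output $V$ with $V\le(1+\epsilon)C^*_{\max}$ that bounds the makespan of a feasible schedule (so $V\ge C^*_{\max}$). Algorithm 3: Choose $\gamma_0,N_0$ with $2^{\gamma_0}=\lceil (m+m_1-1)/(\tfrac{\epsilon}{2} m_1 e_0)\rceil$, $N_0=\lceil m(m+m_1-1)/(\tfrac{\epsilon}{4}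 e_0 m_1)\rceil$; set $q_0=0$, $P_{-1}=0$, and maintain a balanced search tree (B-tree) of quadruples $(\kappa_k,n_k,P_k,JS_k)$, where $\kappa_k=2^{q_0+k+1}$ is the key of group $H_k$ of jobs with $p_j\in(2^{q_0+k},2^{q_0+k+1}]$, $n_k$ its count, $P_k$ its total processing time, and $JS_k$ its stored jobs (kept only while $n_k$ is below the threshold $N_0$). On reading $p_j$, let $k=\lceil\log p_j\rceil-q_0-1$. If a quadruple with key $2^{k+q_0+1}$ exists: increment $n_k$, add $p_j$ to $P_k$, add $j$ to $JS_k$ if $n_k\le N_0$, else reset $JS_k=\emptyset$. Otherwise: if $p_j\le 2^{q_0}$, add $p_j$ to $P_{-1}$; else if $p_j\le 2^{q_0+\gamma_0+1}$, insert $(2^{q_0+k+1},1,p_j,\{j\})$; else set $q_0'=\lceil\log p_j\rceil-\gamma_0-1$, for every quadruple with key $\le 2^{q_0'}$ add its $P_k$ to $P_{-1}$ and delete it, insert $(2^{q_0'+\gamma_0+1},1,p_j,\{j\})$, and set $q_0=q_0'$. After the stream: $P=P_{-1}+\sum_kP_k$; $k_L$ is the largest $k\in\{0,\dots,\gamma_0\}$ with $n_k\ge N_0$ ($-1$ if none); $JS=\bigcup_{k>k_L}JS_k$. For each assignment of $JS$ to machines (large-job loads $P^L_i$), find $t$ with (a) $A(t)\ge P$ and (b) $A_i(t)\ge P^L_i$ for all $i$, while (a) or (b) fails at $t/(1+\epsilon/2)$. With $t$ the smallest such value, return $t+\lceil\frac{m-1}{m_1}\rceil\cdot\frac1{e_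0}\cdot2^{q_0+k_L+1}$.
   Formalization: The factor 1+ε fails with q_0=0 (one job p=2, all ratios 1), so it is proved for initial q_0=-∞ (first job sets q_0), and for finite initial q_0 only if p_max ≥ 2^(q_0+γ_0); γ_0 is the least integer with 2^γ_0 ≥ the ceiling, and logarithms in the bounds are at least 1. *)

(* Defs.v *)
(* MathComp / MathComp-Analysis development; the reals are an arbitrary
   [R : realType]. *)
From HB Require Import structures.
From mathcomp Require Import all_boot all_order all_algebra.
From mathcomp Require Import boolp classical_sets reals exp.
Set Implicit Arguments.
Unset Strict Implicit.
Unset Printing Implicit Defensive.
Import Order.TTheory GRing.Theory Num.Theory.
Local Open Scope ring_scope.

(** * Machines with sharing ratios, schedules, optimal makespan *)

(* [Machine e1 [:: (t1, e2); ...; (t_r, e_(r+1))]] has the intervals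
   (0, t1], (t1, t2], ..., (t_r, +oo) with ratios e1, e2, ..., e_(r+1). *)
Record machine (R : realType) := Machine {
  ratio1 : R;
  later : seq (R * R) }.

Definition ratios (R : realType) (M : machine R) : seq R :=
  ratio1 M :: [seq x.2 | x <- later M].

Definition valid_machine (R : realType) (M : machine R) : Prop :=
  path <%R 0 [seq x.1 | x <- later M] /\
  (forall e, e \in ratios M -> 0 < e <= 1).

Definition n_intervals (R : realType) (M : machine R) : nat := size (ratios M).

Definition n_shared (R : realType) (M : machine R) : nat :=
  count (fun e => e < 1) (ratios M).

(* Processing available in (a, t] when the current interval starts at a. *)
Fixpoint avail_from (R : realType) (a e : R) (s : seq (R * R)) (t : R) : R :=
  if s is (b, e') :: s' then
    if t <= b then (t - a) * e else (b - a) * e + avail_from b e' s' t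
  else (t - a) * e.

(* A_i(t) *)
Definition avail (R : realType) (M : machine R) (t : R) : R :=
  avail_from 0 (ratio1 M) (later M) t.

Record schedule (R : realType) (m n : nat) := Schedule {
  s_mach : 'I_n -> 'I_m;
  s_start : 'I_n -> R;
  s_end : 'I_n -> R }.

(* A job occupies its machine during all of (s_start, s_end] and receives there
   exactly its processing time. *)
Definition feasible (R : realType) (m : nat) (Ms : m.-tuple (machine R))
    (p : seq R) (S : schedule R m (size p)) : Prop :=
  (forall j, 0 <= s_start S j <= s_end S j) /\
  (forall j, avail (tnth Ms (s_mach S j)) (s_end S j)
             - avail (tnth Ms (s_mach S j)) (s_start S j) = nth 0 p j) /\
  (forall j j', j != j' -> s_mach S j = s_mach S j' ->
     s_end S j <= s_start S j' \/ s_end S j' <= s_start S j).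

Definition makespan (R : realType) (m n : nat) (S : schedule R m n) : R :=
  \big[Num.max/0]_(j < n) s_end S j.

Definition opt_makespan (R : realType) (m : nat) (Ms : m.-tuple (machine R))
    (p : seq R) : R :=
  inf [set makespan S | S in [set S : schedule R m (size p) | feasible Ms S]]%classic.

(** * Cost model: a unit-cost real RAM *)

(* A computation with its running time and the peak number of words it uses on
   top of the data it is given. *)
Record run (A : Type) := Run { result : A; time : nat; peak : nat }.

Definition ret (A : Type) (a : A) : run A := Run a 0 0.

(* Sequential composition reuses workspace.  Data that must survive while other
   code runs are accounted for by [hold] or by the frame of [call]. *)
Definition bind (A B : Type) (c : run A) (f : A -> run B) : run B :=
  let r := f (result c) in
  Run (result r) (time c + time r)%N (maxn (peak c) (peak r)).

Notation "'let!' x ':=' c 'in' f" := (bind c (fun x => f))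
  (at level 200, x pattern, c at level 200, f at level 200).

(* A bounded number of elementary operations (+, -, *, /, comparison, ceiling of a
   binary logarithm, integer power of two, array access, allocation of a cell),
   charged as one unit.  All the work of the algorithm below goes through [op]. *)
Definition op (A : Type) (a : A) : run A := Run a 1 1.

(* A non-tail call; the activation record (locals, and the cells being rebuilt by
   this activation) takes a constant number of words. *)
Definition frame_words : nat := 16.
Definition call (A : Type) (c : run A) : run A :=
  Run (result c) (time c).+1 (frame_words + peak c)%N.

(* w words stay allocated while c runs *)
Definition hold (A : Type) (w : nat) (c : run A) : run A :=
  Run (result c) (time c) (w + peak c)%N.

(** * One-pass streaming algorithms *)

(* The length of the stream is not available to any component, and the output
   is computed from the final memory state only. *)
Record stream_alg (X St V : Type) := StreamAlg {
  sa_init : St;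
  sa_step : St -> X -> run St;
  sa_out : St -> run V;
  sa_words : St -> nat }.

Definition sa_state (X St V : Type) (alg : stream_alg X St V) (s : seq X) : St :=
  foldl (fun st x => result (sa_step alg st x)) (sa_init alg) s.

Definition sa_output (X St V : Type) (alg : stream_alg X St V) (s : seq X) : run V :=
  sa_out alg (sa_state alg s).

(* time spent on the job read after the prefix s *)
Definition sa_job_time (X St V : Type) (alg : stream_alg X St V) (s : seq X) (x : X)
    : nat :=
  time (sa_step alg (sa_state alg s) x).

(* peak memory over the whole execution (pass and output phase) *)
Fixpoint sa_space_from (X St V : Type) (alg : stream_alg X St V) (st : St) (s : seq X)
    : nat :=
  if s is x :: s' then
    maxn (sa_words alg st + peak (sa_step alg st x))
         (sa_space_from alg (result (sa_step alg st x)) s')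
  else (sa_words alg st + peak (sa_out alg st))%N.

Definition sa_space (X St V : Type) (alg : stream_alg X St V) (s : seq X) : nat :=
  sa_space_from alg (sa_init alg) s.

(** * Quadruples and the search tree (a B-tree of order 3) *)

Record quad (R : realType) := Quad {
  key : R;
  cnt : nat;
  tot : R;
  jobs : seq R }.

Inductive btree (R : realType) :=
| Leaf
| N2 of btree R & quad R & btree R
| N3 of btree R & quad R & btree R & quad R & btree R.
Arguments Leaf {R}.

Fixpoint quads (R : realType) (t : btree R) : seq (quad R) :=
  match t with
  | Leaf => [::]
  | N2 l a r => quads l ++ a :: quads r
  | N3 l a c b r => quads l ++ a :: quads c ++ b :: quads r
  end.

Definition quad_words (R : realType) (a : quad R) : nat := (4 + 2 * size (jobs a))%N.

Fixpoint btree_words (R : realType) (t : btree R) : nat :=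
  match t with
  | Leaf => 1
  | N2 l a r => 3 + quad_words a + btree_words l + btree_words r
  | N3 l a c b r => 5 + quad_words a + quad_words b
                    + btree_words l + btree_words c + btree_words r
  end%N.

Fixpoint bt_find (R : realType) (x : R) (t : btree R) : run (option (quad R)) :=
  match t with
  | Leaf => op None
  | N2 l a r =>
      let! e := op (x == key a) in
      if e then op (Some a) else
      let! d := op (x < key a) in
      if d then call (bt_find x l) else call (bt_find x r)
  | N3 l a c b r =>
      let! e := op (x == key a) in
      if e then op (Some a) else
      let! e' := op (x == key b) in
      if e' then op (Some b) else
      let! d := op (x < key a) in
      if d then call (bt_find x l) else
      let! d' := op (x < key b) in
      if d' then call (bt_find x c) else call (bt_find x r)
  end.

(* Result of an insertion into a subtree: same height, or split in two. *)
Inductive grown (R : realType) :=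
| Same of btree R
| Split of btree R & quad R & btree R.

(* Insert a, or replace the quadruple that has the same key. *)
Fixpoint bt_ins (R : realType) (a : quad R) (t : btree R) : run (grown R) :=
  match t with
  | Leaf => op (Split Leaf a Leaf)
  | N2 l b r =>
      let! e := op (key a == key b) in
      if e then op (Same (N2 l a r)) else
      let! d := op (key a < key b) in
      if d then
        let! u := call (bt_ins a l) in
        op match u with
           | Same l' => Same (N2 l' b r)
           | Split l1 x l2 => Same (N3 l1 x l2 b r)
           end
      else
        let! u := call (bt_ins a r) in
        op match u with
           | Same r' => Same (N2 l b r')
           | Split r1 x r2 => Same (N3 l b r1 x r2)
           end
  | N3 l b c b' r =>
      let! e := op (key a == key b) in
      if e then op (Same (N3 l a c b' r)) else
      let! e' := op (key a == key b') in
      if e' then op (Same (N3 l b c a r)) else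
      let! d := op (key a < key b) in
      if d then
        let! u := call (bt_ins a l) in
        op match u with
           | Same l' => Same (N3 l' b c b' r)
           | Split l1 x l2 => Split (N2 l1 x l2) b (N2 c b' r)
           end
      else
        let! d' := op (key a < key b') in
        if d' then
          let! u := call (bt_ins a c) in
          op match u with
             | Same c' => Same (N3 l b c' b' r)
             | Split c1 x c2 => Split (N2 l b c1) x (N2 c2 b' r)
             end
        else
          let! u := call (bt_ins a r) in
          op match u with
             | Same r' => Same (N3 l b c b' r')
             | Split r1 x r2 => Split (N2 l b c) b' (N2 r1 x r2)
             end
  end.

Definition bt_put (R : realType) (a : quad R) (t : btree R) : run (btree R) :=
  let! u := call (bt_ins a t) in
  op match u with Same t' => t' | Split l x r => N2 l x r end.

(* Result of a deletion in a subtree: same height, or one level shorter. *)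
Inductive shrunk (R : realType) :=
| Kept of btree R
| Short of btree R.

Definition shrunk_tree (R : realType) (u : shrunk R) : btree R :=
  match u with Kept t => t | Short t => t end.

Definition rebal2 (R : realType) (u : shrunk R) (a : quad R) (r : btree R) : shrunk R :=
  match u, r with
  | Short l, N2 r1 b r2 => Short (N3 l a r1 b r2)
  | Short l, N3 r1 b r2 c r3 => Kept (N2 (N2 l a r1) b (N2 r2 c r3))
  | _, _ => Kept (N2 (shrunk_tree u) a r)
  end.

Definition rebal3 (R : realType) (u : shrunk R) (a : quad R) (c : btree R)
    (b : quad R) (r : btree R) : shrunk R :=
  match u, c with
  | Short l, N2 c1 x c2 => Kept (N2 (N3 l a c1 x c2) b r)
  | Short l, N3 c1 x c2 y c3 => Kept (N3 (N2 l a c1) x (N2 c2 y c3) b r)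
  | _, _ => Kept (N3 (shrunk_tree u) a c b r)
  end.

(* Extract the quadruple with the smallest key. *)
Fixpoint bt_del_min (R : realType) (t : btree R) : run (option (quad R * shrunk R)) :=
  match t with
  | Leaf => op None
  | N2 l a r =>
      let! o := call (bt_del_min l) in
      op match o with
         | None => Some (a, Short r)
         | Some (x, u) => Some (x, rebal2 u a r)
         end
  | N3 l a c b r =>
      let! o := call (bt_del_min l) in
      op match o with
         | None => Some (a, Kept (N2 c b r))
         | Some (x, u) => Some (x, rebal3 u a c b r)
         end
  end.

(* Delete every quadruple with key <= bnd, adding its P_k to acc.  The fuel
   only ensures termination. *)
Fixpoint bt_purge (R : realType) (fuel : nat) (bnd : R) (t : btree R) (acc : R)
    : run (btree R * R) :=
  if fuel is f.+1 then
    let! o := call (bt_del_min t) in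
    match o with
    | None => op (t, acc)
    | Some (x, u) =>
        let! d := op (key x <= bnd) in
        if d then
          let! acc' := op (acc + tot x) in
          bt_purge f bnd (shrunk_tree u) acc'
        else op (t, acc)
    end
  else ret (t, acc).

(* In-order list of the quadruples of t, followed by s. *)
Fixpoint bt_flatten (R : realType) (t : btree R) (s : seq (quad R))
    : run (seq (quad R)) :=
  match t with
  | Leaf => op s
  | N2 l a r =>
      let! s1 := call (bt_flatten r s) in
      let! s2 := op (a :: s1) in
      call (bt_flatten l s2)
  | N3 l a c b r =>
      let! s1 := call (bt_flatten r s) in
      let! s2 := op (b :: s1) in
      let! s3 := call (bt_flatten c s2) in
      let! s4 := op (a :: s3) in
      call (bt_flatten l s4)
  end.

(** * Algorithm 3: the pass over the stream *)

Record params (R : realType) := Params {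
  pm : nat;
  pm1 : nat;
  pe0 : R;
  peps : R }.

Definition nceil (R : realType) (x : R) : nat := `|Num.ceil x|%N.

Definition clog2 (R : realType) (x : R) : int := Num.ceil (ln x / ln 2).

(* The smallest integer with 2 ^ gamma0 >= ceil((m+m1-1)/((eps/2) m1 e0)), since the
   right-hand side need not be a power of two. *)
Definition gamma0 (R : realType) (prm : params R) : nat :=
  up_log 2 (nceil ((pm prm + pm1 prm - 1)%N%:R
                   / (peps prm / 2 * (pm1 prm)%:R * pe0 prm))).

Definition N0 (R : realType) (prm : params R) : nat :=
  nceil ((pm prm)%:R * (pm prm + pm1 prm - 1)%N%:R
         / (peps prm / 4 * pe0 prm * (pm1 prm)%:R)).

(* [st_q = Some q0]; [None] stands for q0 = -oo and can occur only before the
   first job has been read.  [st_small] is P_(-1). *)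
Record state (R : realType) := State {
  st_q : option int;
  st_small : R;
  st_tree : btree R }.

Definition state_words (R : realType) (st : state R) : nat :=
  (3 + btree_words (st_tree st))%N.

(* Raise q0 so that p falls into the top group. *)
Definition rebase (R : realType) (prm : params R) (st : state R) (p : R)
    : run (state R) :=
  let! z := op (clog2 p) in
  let! q' := op (z - (gamma0 prm)%:Z - 1) in
  let! bnd := op ((2 : R) ^ q') in
  let! tp := bt_purge (size (quads (st_tree st))).+1 bnd (st_tree st) (st_small st) in
  let! top := op ((2 : R) ^ (q' + (gamma0 prm)%:Z + 1)) in
  let! a := op (Quad top 1 p [:: p]) in
  let! t' := bt_put a tp.1 in
  op (State (Some q') tp.2 t').

Definition alg3_step (R : realType) (prm : params R) (st : state R) (p : R)
    : run (state R) :=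
  if st_q st is Some q0 then
    let! z := op (clog2 p) in
    let! k := op (z - q0 - 1) in
    let! x := op ((2 : R) ^ (k + q0 + 1)) in
    let! o := call (bt_find x (st_tree st)) in
    if o is Some a then
      let! n' := op (cnt a).+1 in
      let! P' := op (tot a + p) in
      let! b := op (n' <= N0 prm)%N in
      let! js := op (if b then p :: jobs a else [::]) in
      let! a' := op (Quad x n' P' js) in
      let! t' := bt_put a' (st_tree st) in
      op (State (Some q0) (st_small st) t')
    else
      let! lo := op ((2 : R) ^ q0) in
      let! b := op (p <= lo) in
      if b then
        let! s' := op (st_small st + p) in
        op (State (Some q0) s' (st_tree st))
      else
        let! hi := op ((2 : R) ^ (q0 + (gamma0 prm)%:Z + 1)) in
        let! b' := op (p <= hi) in
        if b' then
          let! a := op (Quad x 1 p [:: p]) in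
          let! t' := bt_put a (st_tree st) in
          op (State (Some q0) (st_small st) t')
        else rebase prm st p
  else rebase prm st p.

(** * Algorithm 3: the output phase *)

(* Table of a machine: entries (T_k, A(T_k), rate on (T_k, T_(k+1)]), T_0 = 0. *)
Fixpoint mk_table (R : realType) (T A e : R) (s : seq (R * R))
    : run (seq (R * R * R)) :=
  if s is (b, e') :: s' then
    let! d := op (b - T) in
    let! w := op (d * e) in
    let! A' := op (A + w) in
    let! tb := call (mk_table b A' e' s') in
    op ((T, A, e) :: tb)
  else op [:: (T, A, e)].

Fixpoint mk_tables (R : realType) (Ms : seq (machine R))
    : run (seq (seq (R * R * R))) :=
  if Ms is M :: Ms' then
    let! tb := call (mk_table 0 0 (ratio1 M) (later M)) in
    let! tbs := call (mk_tables Ms') in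
    op (tb :: tbs)
  else op [::].

(* Binary search for the last k in [lo, lo + len) with T_k <= t (k = lo if none).
   The fuel only ensures termination. *)
Fixpoint locate (R : realType) (fuel : nat) (tb : seq (R * R * R)) (lo len : nat)
    (t : R) : run nat :=
  if fuel is f.+1 then
    let! c := op (len <= 1)%N in
    if c then op lo else
    let! h := op len./2 in
    let! mid := op (lo + h)%N in
    let! x := op (nth (0, 0, 0) tb mid) in
    let! d := op (x.1.1 <= t) in
    if d then
      let! len' := op (len - h)%N in
      locate f tb mid len' t
    else locate f tb lo h t
  else ret lo.

Definition eval_table (R : realType) (tb : seq (R * R * R)) (t : R) : run R :=
  let! len := op (size tb) in
  let! k := call (locate len tb 0 len t) in
  let! x := op (nth (0, 0, 0) tb k) in
  let! d := op (t - x.1.1) in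
  let! w := op (d * x.2) in
  op (x.1.2 + w).

(* Do (a) A(t) >= P and (b) A_i(t) >= P^L_i hold?  [acc] accumulates A(t). *)
Fixpoint test (R : realType) (tbs : seq (seq (R * R * R))) (loads : seq R)
    (P t acc : R) : run bool :=
  match tbs, loads with
  | tb :: tbs', ld :: loads' =>
      let! a := call (eval_table tb t) in
      let! ok := op (ld <= a) in
      if ok then
        let! acc' := op (acc + a) in
        test tbs' loads' P t acc'
      else op false
  | _, _ => op (P <= acc)
  end.

(* h successive squares of g in decreasing order, followed by acc. *)
Fixpoint squares (R : realType) (h : nat) (g : R) (acc : seq R) : run (seq R) :=
  if h is h'.+1 then
    let! acc' := op (g :: acc) in
    let! g' := op (g * g) in
    squares h' g' acc'
  else ret acc.

(* Binary search on the exponent: if [test] fails at t and [gs] lists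
   g ^ (2 ^ (h-1)), ..., g ^ 2, g, return the largest t * g ^ x with
   0 <= x < 2 ^ h at which it fails. *)
Fixpoint bsearch (R : realType) (tbs : seq (seq (R * R * R))) (loads : seq R)
    (P : R) (gs : seq R) (t : R) : run R :=
  if gs is g :: gs' then
    let! t' := op (t * g) in
    let! ok := call (test tbs loads P t' 0) in
    if ok then bsearch tbs loads P gs' t else bsearch tbs loads P gs' t'
  else op t.

Fixpoint load_of (R : realType) (i : nat) (asg : seq (nat * R)) (acc : R) : run R :=
  if asg is (i', p) :: asg' then
    let! c := op (i' == i) in
    let! acc' := op (if c then acc + p else acc) in
    load_of i asg' acc'
  else op acc.

Fixpoint loads_of (R : realType) (idx : seq nat) (asg : seq (nat * R)) : run (seq R) :=
  if idx is i :: idx' then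
    let! x := call (load_of i asg 0) in
    let! xs := call (loads_of idx' asg) in
    op (x :: xs)
  else op [::].

(* Treat one assignment of the stored jobs and keep the smallest t found so far.
   The search range is [P/m, (P/m) (1+eps/2) ^ (2^h - 1)], whose upper end is at
   least P/e0, the value sufficient when all jobs are put on the first machine;
   an assignment with no suitable t in the range cannot attain the minimum. *)
Definition try_assignment (R : realType) (prm : params R)
    (tbs : seq (seq (R * R * R))) (P : R) (gs : seq R)
    (asg : seq (nat * R)) (best : option R) : run (option R) :=
  hold (2 * pm prm)
   (let! loads := call (loads_of (iota 0 (pm prm)) asg) in
    let! x := op (P / (pm prm)%:R) in
    let! g := op (1 + peps prm / 2) in
    let! t0 := op (x / g) in
    let! t1 := call (bsearch tbs loads P gs t0) in
    let! t := op (t1 * g) in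
    let! ok := call (test tbs loads P t 0) in
    if ok then
      op (if best is Some b then Some (Num.min b t) else Some t)
    else op best).

(* Depth-first enumeration of all assignments of [js] extending [asg]. *)
Fixpoint enum_assignments (R : realType) (prm : params R)
    (tbs : seq (seq (R * R * R))) (P : R) (gs : seq R)
    (js : seq R) (asg : seq (nat * R)) (best : option R) : run (option R) :=
  if js is p :: js' then
    (fix loop (idx : seq nat) (best : option R) : run (option R) :=
       if idx is i :: idx' then
         let! asg' := op ((i, p) :: asg) in
         let! best' := call (enum_assignments prm tbs P gs js' asg' best) in
         loop idx' best'
       else op best) (iota 0 (pm prm)) best
  else call (try_assignment prm tbs P gs asg best).

Fixpoint total (R : realType) (qs : seq (quad R)) (acc : R) : run R :=
  if qs is a :: qs' then
    let! acc' := op (acc + tot a) in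
    total qs' acc'
  else op acc.

(* For qs sorted by increasing keys: the key 2 ^ (q0 + k_L + 1) of the last group
   with at least N0 jobs; dflt = 2 ^ q0 (that is, k_L = -1) if there is none. *)
Fixpoint heavy_key (R : realType) (prm : params R) (qs : seq (quad R)) (dflt : R)
    : run R :=
  if qs is a :: qs' then
    let! c := op (N0 prm <= cnt a)%N in
    heavy_key prm qs' (if c then key a else dflt)
  else op dflt.

Fixpoint append (A : Type) (s1 s2 : seq A) : run (seq A) :=
  if s1 is x :: s1' then
    let! s := call (append s1' s2) in
    op (x :: s)
  else op s2.

(* JS: the jobs stored in the groups with key > kL *)
Fixpoint large_jobs (R : realType) (kL : R) (qs : seq (quad R)) : run (seq R) :=
  if qs is a :: qs' then
    let! js := call (large_jobs kL qs') in
    let! c := op (kL < key a) in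
    if c then call (append (jobs a) js) else op js
  else op [::].

(* h with 2 ^ h >= 1 + log_(1+eps/2) (m/e0) *)
Definition search_depth (R : realType) (prm : params R) : nat :=
  up_log 2 (nceil (ln ((pm prm)%:R / pe0 prm) / ln (1 + peps prm / 2))).+1.

(* The argument of the outer [hold] reserves the tables, the flattened tree, the
   list JS and the list of squares for the whole phase. *)
Definition alg3_out (R : realType) (prm : params R) (Ms : seq (machine R))
    (st : state R) : run R :=
  if st_q st is Some q0 then
    let qs0 := quads (st_tree st) in
    hold (4 * sumn [seq n_intervals M | M <- Ms] + 2 * size Ms + 2 * size qs0
          + 2 * sumn [seq size (jobs a) | a <- qs0] + 2 * search_depth prm)
     (let! tbs := call (mk_tables Ms) in
      let! qs := call (bt_flatten (st_tree st) [::]) in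
      let! P := call (total qs (st_small st)) in
      let! lo := op ((2 : R) ^ q0) in
      let! kL := call (heavy_key prm qs lo) in
      let! js := call (large_jobs kL qs) in
      let! h := op (search_depth prm) in
      let! g := op (1 + peps prm / 2) in
      let! gs := call (squares h g [::]) in
      let! best := call (enum_assignments prm tbs P gs js [::] None) in
      let! c := op (nceil ((pm prm - 1)%N%:R / (pm1 prm)%:R : R)) in
      let! d := op (c%:R * (pe0 prm)^-1) in
      let! w := op (d * kL) in
      op (odflt 0 best + w))
  else op 0.

(* The machine data are known in advance and stay in memory, hence the first two
   summands of [sa_words].  [q_init] is the initial value of q0. *)
Definition alg3 (R : realType) (prm : params R) (q_init : option int)
    (Ms : seq (machine R)) : stream_alg R (state R) R :=
  StreamAlg (State q_init 0 Leaf)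
    (alg3_step prm)
    (alg3_out prm Ms)
    (fun st => 2 * sumn [seq n_intervals M | M <- Ms] + 2 * size Ms
               + state_words st)%N.

(** * Bounds *)

(* Logarithms in asymptotic bounds are never smaller than 1. *)
Definition lg (R : realType) (x : R) : R := Num.max 1 (ln x / ln 2).

(* c * (ntilde + m^2/(eps e0 m1) log (m/(eps e0))) *)
Definition space_bound (R : realType) (c : R) (prm : params R) (ntilde : nat) : R :=
  let m := (pm prm)%:R in let m1 := (pm1 prm)%:R in
  let e0 := pe0 prm in let eps := peps prm in
  c * (ntilde%:R + m ^+ 2 / (eps * e0 * m1) * lg (m / (eps * e0))).

(* t_1, with c as the constant of the O in the exponent; ks lists the k_i *)
Definition t1_bound (R : realType) (c : R) (prm : params R) (ks : seq nat) : R :=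
  let m := (pm prm)%:R in let m1 := (pm1 prm)%:R in
  let e0 := pe0 prm in let eps := peps prm in
  m `^ (c * (m ^+ 2 / (eps * e0 * m1) * lg (m / (eps * e0 * m1))))
  * lg (1 / eps * lg (m / e0))
  * \sum_(k <- ks) lg k%:R.

(* Main.v *)
Require Import Defs.
From HB Require Import structures.
From mathcomp Require Import all_boot all_order all_algebra.
From mathcomp Require Import boolp classical_sets reals exp.
From mathcomp Require Import zify ring lra.
Set Implicit Arguments.
Unset Strict Implicit.
Unset Printing Implicit Defensive.
Import Order.TTheory GRing.Theory Num.Theory.
Local Open Scope ring_scope.

(** The quantity m + m1 - 1 in [gamma0] and [N0] comes from m1 * ceil((m-1)/m1) <= m + m1 - 1. The
    extra factor 2m in [N0] pays for two losses: a job of the heavy group may be only slightly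
    larger than K/2, and the total P is only known to be at most m T. The values t are sought on the
    geometric grid (P/m) g^x with g = 1 + eps/2. All assignments fail just below the grid because
    rates are at most 1. An assignment failing on the whole grid is harmless: placing all of JS on
    the first machine then gives a smaller t. With a finite initial q0, tiny jobs could make the
    additive term dominate the optimum, hence the condition that some job reaches 2^(q0+gamma0).
    Once q0 has been set by a job, that job satisfies it. Time per job is O(1) in the sense of a
    bound in the parameters alone, so costs linear in the number of nodes, even quadratic for a
    purge, are affordable. In the output time, m^|JS| is charged twice: the second copy absorbs the
    factors polynomial in |JS|. *)

(* After any prefix, the tree holds exactly the groups (2^(z-1), 2^z] with z > q0 that
   contain a job read so far, with complete counts and totals (a group above q0 is
   never purged), and P_(-1) is the total of the jobs of size at most 2^q0.

   Let t be the smallest value found and K = 2^(q0+k_L+1).  Filling the machines up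
   to A_i(t) one after the other with the jobs outside JS, each of size at most K,
   leaves at most m-1 overflowing jobs; spreading them evenly over M_1, ..., M_(m1)
   delays these machines by at most ceil((m-1)/m1) K / e0, so the output bounds the
   makespan of a schedule.  Conversely a schedule of makespan T induces an assignment
   of JS for which (a) and (b) hold at T, whence t <= (1+eps/2) T, and the additive
   term is at most (eps/2) T: if k_L = -1 because K is at most p_max / 2^gamma0, and
   otherwise because N0 jobs are larger than K/2.

   The number of nodes in the tree is at most gamma0 + 1 and |JS| is at most
   (gamma0 + 1) N0 = O(m^2/(eps e0 m1) log (m/(eps e0 m1))), from which all the
   bounds on time and space follow. *)

(** * Search trees *)

(** List models of the tree operations. Facts about the tree are transferred to its in-order
    sequence [quads], so node shapes and rebalancing disappear from the invariant of the pass. *)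
Fixpoint ins (R : realType) (a : quad R) (s : seq (quad R)) : seq (quad R) :=
  if s is b :: s' then
    if key a == key b then a :: s'
    else if key a < key b then a :: s else b :: ins a s'
  else [:: a].

Fixpoint lookup (R : realType) (x : R) (s : seq (quad R)) : option (quad R) :=
  if s is b :: s' then if x == key b then Some b else lookup x s' else None.

Definition key_sorted (R : realType) (s : seq (quad R)) : bool :=
  pairwise <%R (map (@key R) s).

Definition grown_quads (R : realType) (u : grown R) : seq (quad R) :=
  match u with Same t => quads t | Defs.Split l x r => quads l ++ x :: quads r end.

Lemma ins_cat_ge (R : realType) (a : quad R) s1 s2 :
  all (fun x => key x < key a) s1 -> ins a (s1 ++ s2) = s1 ++ ins a s2.
Proof.
elim: s1 => //= x s1 IH /andP[lt_xa /IH ->].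
by rewrite gt_eqF // ltNge ltW.
Qed.

Lemma ins_cat_gt (R : realType) (a b : quad R) s1 s2 :
  all (fun x => key x < key b) s1 -> key b < key a ->
  ins a (s1 ++ b :: s2) = s1 ++ b :: ins a s2.
Proof.
move=> s1b lt_ba; rewrite ins_cat_ge /=; first by rewrite gt_eqF // ltNge ltW.
by apply: sub_all s1b => x /lt_trans; apply.
Qed.

Lemma ins_cat_eq (R : realType) (a b : quad R) s1 s2 :
  all (fun x => key x < key b) s1 -> key a = key b ->
  ins a (s1 ++ b :: s2) = s1 ++ a :: s2.
Proof. by move=> s1b eq_ab; rewrite ins_cat_ge /= eq_ab ?eqxx. Qed.

Lemma ins_cat_lt (R : realType) (a b : quad R) s1 s2 :
  key a < key b -> ins a (s1 ++ b :: s2) = ins a s1 ++ b :: s2.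
Proof.
move=> lt_ab; elim: s1 => [|x s1 IH] /=; first by rewrite lt_eqF // lt_ab.
by rewrite IH; case: ifP => // _; case: ifP.
Qed.

Lemma lookup_cat_ge (R : realType) (x : R) s1 s2 :
  all (fun a => key a < x) s1 -> lookup x (s1 ++ s2) = lookup x s2.
Proof. by elim: s1 => //= a s1 IH /andP[lt_ax /IH ->]; rewrite gt_eqF. Qed.

Lemma lookup_cat_lt (R : realType) (x : R) s1 s2 :
  all (fun a => x < key a) s2 -> lookup x (s1 ++ s2) = lookup x s1.
Proof.
elim: s1 => [|a s1 IH] /= H; last by rewrite IH.
by elim: s2 H => //= a s2 IH /andP[lt_xa /IH ->]; rewrite lt_eqF.
Qed.

Lemma key_sorted_cat_cons (R : realType) (s1 s2 : seq (quad R)) (a : quad R) :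
  key_sorted (s1 ++ a :: s2) ->
  [/\ key_sorted s1, key_sorted s2, all (fun x => key x < key a) s1
    & all (fun x => key a < key x) s2].
Proof.
rewrite /key_sorted map_cat pairwise_cat /= allrel_consr.
by case/and3P=> /andP[H12 _] -> /andP[Ha ->]; rewrite !all_map in H12 Ha.
Qed.

Lemma all_key_lt (R : realType) (x y : R) (s : seq (quad R)) :
  x < y -> all (fun a => key a < x) s -> all (fun a => key a < y) s.
Proof. by move=> lt_xy; apply: sub_all => a /lt_trans; apply. Qed.

Lemma all_key_gt (R : realType) (x y : R) (s : seq (quad R)) :
  x < y -> all (fun a => y < key a) s -> all (fun a => x < key a) s.
Proof. by move=> lt_xy; apply: sub_all => a; apply: lt_trans. Qed.

Lemma bt_find_lookup (R : realType) (x : R) (t : btree R) :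
  key_sorted (quads t) -> result (bt_find x t) = lookup x (quads t).
Proof.
elim: t => [|l IHl a r IHr|l IHl a c IHc b r IHr] //=.
  case/key_sorted_cat_cons => sl sr la ar.
  case: (ltgtP x (key a)) => [lt_xa|lt_ax|eq_xa] /=.
  - rewrite IHl // lookup_cat_lt //= lt_xa; exact: all_key_gt ar.
  - by rewrite IHr // lookup_cat_ge ?(all_key_lt lt_ax) //= gt_eqF.
  - by rewrite lookup_cat_ge ?eq_xa //= eqxx.
case/key_sorted_cat_cons => sl scr la acr.
have [sc sr cb br] := key_sorted_cat_cons scr.
have lt_ab : key a < key b by move: acr; rewrite all_cat /= => /and3P[].
case: (ltgtP x (key a)) => [lt_xa|lt_ax|eq_xa] /=.
- rewrite lt_eqF ?(lt_trans lt_xa) //= IHl // lookup_cat_lt //= lt_xa.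
  exact: all_key_gt acr.
- rewrite lookup_cat_ge ?(all_key_lt lt_ax) //= (gt_eqF lt_ax).
  case: (ltgtP x (key b)) => [lt_xb|lt_bx|eq_xb] /=.
  + rewrite IHc // lookup_cat_lt //= lt_xb; exact: all_key_gt br.
  + by rewrite IHr // lookup_cat_ge ?(all_key_lt lt_bx) //= gt_eqF.
  + by rewrite lookup_cat_ge ?eq_xb //= eqxx.
- by rewrite lookup_cat_ge ?eq_xa //= eqxx.
Qed.

Lemma quads_bt_ins (R : realType) (a : quad R) (t : btree R) :
  key_sorted (quads t) ->
  grown_quads (result (bt_ins a t)) = ins a (quads t).
Proof.
elim: t => [|l IHl b r IHr|l IHl b c IHc b' r IHr] //=.
  case/key_sorted_cat_cons => /IHl{}IHl /IHr{}IHr lb br.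
  case: (ltgtP (key a) (key b)) => [lt_ab|lt_ba|eq_ab] /=.
  - rewrite ins_cat_lt // -IHl.
    by case: (result _) => //= *; rewrite -catA.
  - by rewrite ins_cat_gt // -IHr; case: (result _).
  - by rewrite ins_cat_eq.
case/key_sorted_cat_cons => /IHl{}IHl scr lb bcr.
have [/IHc{}IHc /IHr{}IHr cb br] := key_sorted_cat_cons scr.
have lt_bb : key b < key b' by move: bcr; rewrite all_cat /= => /and3P[].
case: (ltgtP (key a) (key b)) => [lt_ab|lt_ba|eq_ab] /=.
- rewrite lt_eqF ?(lt_trans lt_ab) //= ins_cat_lt // -IHl.
  by case: (result _) => //= *; rewrite -catA.
- rewrite ins_cat_gt //.
  case: (ltgtP (key a) (key b')) => [lt_ab'|lt_b'a|eq_ab'] /=.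
  + rewrite ins_cat_lt // -IHc.
    by case: (result _) => //= *; rewrite -!catA /= -?catA.
  + rewrite ins_cat_gt // -IHr.
    by case: (result _) => //= *; rewrite -!catA.
  + by rewrite ins_cat_eq.
- by rewrite ins_cat_eq.
Qed.

Lemma quads_bt_put (R : realType) (a : quad R) (t : btree R) :
  key_sorted (quads t) -> quads (result (bt_put a t)) = ins a (quads t).
Proof. by move=> /(quads_bt_ins a) <-; rewrite /bt_put /=; case: (result _). Qed.

Lemma quads_rebal2 (R : realType) (u : shrunk R) a r :
  quads (shrunk_tree (rebal2 u a r)) = quads (shrunk_tree u) ++ a :: quads r.
Proof. by case: u => // l; case: r => //= *; rewrite -?catA //= -?catA. Qed.

Lemma quads_rebal3 (R : realType) (u : shrunk R) a c b r :
  quads (shrunk_tree (rebal3 u a c b r))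
  = quads (shrunk_tree u) ++ a :: quads c ++ b :: quads r.
Proof. by case: u => // l; case: c => //= *; rewrite -?catA //= -?catA. Qed.

Lemma quads_bt_del_min (R : realType) (t : btree R) :
  quads t = if result (bt_del_min t) is Some (x, u)
            then x :: quads (shrunk_tree u) else [::].
Proof.
elim: t => [|l IHl a r _|l IHl a c _ b r _] //=.
  by rewrite IHl; case: (result _) => [[x u]|] //=; rewrite quads_rebal2.
by rewrite IHl; case: (result _) => [[x u]|] //=; rewrite quads_rebal3.
Qed.

Lemma quads_bt_flatten (R : realType) (t : btree R) (s : seq (quad R)) :
  result (bt_flatten t s) = quads t ++ s.
Proof.
elim: t s => [|l IHl a r IHr|l IHl a c IHc b r IHr] //= s.
  by rewrite IHr IHl -catA.
by rewrite IHr IHc IHl -catA /= -catA.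
Qed.

(** A descent visits each node at most once, so a bound linear in the number of quadruples holds for
    every shape of tree; that number will be at most [gamma0 + 1]. The 16 is [frame_words], one
    activation record per level. *)
Lemma bt_find_cost (R : realType) (x : R) (t : btree R) :
  (time (bt_find x t) <= 6 * size (quads t) + 1)%N /\
  (peak (bt_find x t) <= 16 * size (quads t) + 1)%N.
Proof.
by elim: t => [|l [] ? ? a r [] ? ?|l [] ? ? a c [] ? ? b r [] ? ?] //=;
  rewrite /frame_words ?size_cat /= ?size_cat /= //; split;
  repeat (case: ifP => _ /=); rewrite ?/frame_words; lia.
Qed.

Lemma bt_ins_cost (R : realType) (a : quad R) (t : btree R) :
  (time (bt_ins a t) <= 6 * size (quads t) + 1)%N /\
  (peak (bt_ins a t) <= 16 * size (quads t) + 1)%N.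
Proof.
by elim: t => [|l [] ? ? b r [] ? ?|l [] ? ? b c [] ? ? b' r [] ? ?] //=;
  rewrite /frame_words ?size_cat /= ?size_cat /= //; split;
  repeat (case: ifP => _ /=); rewrite ?/frame_words; lia.
Qed.

Lemma bt_put_cost (R : realType) (a : quad R) (t : btree R) :
  (time (bt_put a t) <= 6 * size (quads t) + 3)%N /\
  (peak (bt_put a t) <= 16 * size (quads t) + 17)%N.
Proof. by have [] := bt_ins_cost a t; rewrite /= /frame_words; lia. Qed.

Lemma bt_del_min_cost (R : realType) (t : btree R) :
  (time (bt_del_min t) <= 2 * size (quads t) + 1)%N /\
  (peak (bt_del_min t) <= 16 * size (quads t) + 1)%N.
Proof.
elim: t => [|l [] ? ? a r _|l [] ? ? a c _ b r _] //=;
  rewrite /frame_words ?size_cat /= ?size_cat /= //; split; lia.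
Qed.

Lemma bt_flatten_cost (R : realType) (t : btree R) (s : seq (quad R)) :
  (time (bt_flatten t s) <= 4 * size (quads t) + 1)%N /\
  (peak (bt_flatten t s) <= 16 * size (quads t) + 1)%N.
Proof.
elim: t s => [|l IHl a r IHr|l IHl a c IHc b r IHr] //= s.
  have [? ?] := IHr s.
  have [? ?] := IHl (a :: result (bt_flatten r s)).
  by rewrite /frame_words ?size_cat /= ?size_cat /=; split; lia.
have [? ?] := IHr s.
have [? ?] := IHc (b :: result (bt_flatten r s)).
have [? ?] := IHl (a :: result (bt_flatten c (b :: result (bt_flatten r s)))).
by rewrite /frame_words ?size_cat /= ?size_cat /=; split; lia.
Qed.

(** The loop is a tail call, so its peak is that of one framed [bt_del_min], whereas the times of
    the rounds add up. *)
Lemma bt_purge_cost (R : realType) (f : nat) (bnd : R) (t : btree R) (acc : R) :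
  (time (bt_purge f bnd t acc) <= f * (2 * size (quads t) + 4))%N /\
  (peak (bt_purge f bnd t acc) <= 16 * size (quads t) + 17)%N.
Proof.
elim: f t acc => [|f IH] t acc //=.
have [? ?] := bt_del_min_cost t.
have := quads_bt_del_min t; case: (result (bt_del_min t)) => [[x u]|] Et /=.
  have [] := IH (shrunk_tree u) (acc + tot x); rewrite Et /= /frame_words.
  move: Et => /(congr1 size) /= Et.
  move=> H1 H2.
  have H3 : (f * (2 * size (quads (shrunk_tree u)) + 4) <=
             f * (2 * (size (quads (shrunk_tree u))).+1 + 4))%N.
    by rewrite leq_mul2l; apply/orP; right; lia.
  by case: ifP => _ /=; split; lia.
by rewrite /frame_words; split; lia.
Qed.

(** The 4 words added to each quadruple pay for the three words of its [N2] node and for the one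
    additional leaf; an [N3] node is cheaper than two [N2] nodes. *)
Lemma btree_words_le (R : realType) (t : btree R) :
  (btree_words t <= 1 + \sum_(a <- quads t) (quad_words a + 4))%N.
Proof.
elim: t => [|l IHl a r IHr|l IHl a c IHc b r IHr] /=; rewrite ?big_nil //.
  by rewrite big_cat big_cons /=; lia.
by rewrite big_cat big_cons /= big_cat big_cons /=; lia.
Qed.

(** * The state after a prefix of the stream *)

Lemma le_exp2z (R : realType) : {mono (fun z : int => (2 : R) ^ z) : x y / x <= y}.
Proof. by move=> x y; rewrite ler_eXz2l // ltr1n. Qed.

Lemma lt_exp2z (R : realType) : {mono (fun z : int => (2 : R) ^ z) : x y / x < y}.
Proof. by move=> x y; rewrite ltr_eXz2l // ltr1n. Qed.

Lemma eq_exp2z (R : realType) (x y : int) : ((2 : R) ^ x == 2 ^ y) = (x == y).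
Proof. by rewrite !eq_le !le_exp2z. Qed.

Lemma exp2z_gt0 (R : realType) (z : int) : 0 < (2 : R) ^ z.
Proof. by rewrite exprz_gt0. Qed.

Lemma ln2_gt0 (R : realType) : 0 < ln (2 : R).
Proof. by rewrite ln_gt0 // ltr1n. Qed.

Lemma ln_exp2z (R : realType) (z : int) : ln ((2 : R) ^ z) = z%:~R * ln 2.
Proof. by rewrite -powR_intmul // ln_powR. Qed.

(** Adjunction between [clog2] and powers of two: comparisons of job sizes with thresholds become
    comparisons of integer exponents. *)
Lemma clog2_le (R : realType) (x : R) (z : int) :
  0 < x -> (clog2 x <= z) = (x <= 2 ^ z).
Proof.
move=> x0; rewrite /clog2 ceil_le_int ler_pdivrMr ?ln2_gt0 // -ln_exp2z.
by rewrite ler_ln ?posrE ?exp2z_gt0.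
Qed.

Lemma clog2_gt (R : realType) (x : R) (z : int) :
  0 < x -> (z < clog2 x) = (2 ^ z < x).
Proof. by move=> x0; rewrite !ltNge clog2_le. Qed.

Lemma exp2_clog2_lt (R : realType) (x : R) : 0 < x -> 2 ^ clog2 x < 2 * x.
Proof.
move=> x0; rewrite -{1}(subrK 1 (clog2 x)) expfzDr ?pnatr_eq0 // mulrC.
by rewrite ltr_pM2l // -clog2_gt // gtrBl.
Qed.

(** The jobs in (2^(z-1), 2^z]. Exponents are absolute, not relative to q0 as in the index of H_k,
    so that raising q0 does not renumber the groups. *)
Definition group (R : realType) (s : seq R) (z : int) : seq R :=
  [seq x <- s | clog2 x == z].

(** The quadruple that the pass must hold after the prefix [s]. The reversal reflects that each new
    job is put at the head of the stored list. *)
Definition quad_of (R : realType) (N : nat) (s : seq R) (z : int) : quad R :=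
  Quad (2 ^ z) (size (group s z)) (\sum_(x <- group s z) x)
    (if (size (group s z) <= N)%N then rev (group s z) else [::]).

Fixpoint zins (z : int) (zs : seq int) : seq int :=
  if zs is z' :: zs' then
    if z == z' then z :: zs' else if z < z' then z :: zs else z' :: zins z zs'
  else [:: z].

Lemma mem_zins z zs x : (x \in zins z zs) = (x == z) || (x \in zs).
Proof.
elim: zs => //= z' zs IH; case: eqP => [->|_]; first by rewrite !inE orbA orbb.
by case: ifP => _; rewrite !inE ?IH //; case: (x == z); rewrite ?orbT.
Qed.

Lemma pairwise_zins z zs : pairwise <%R zs -> pairwise <%R (zins z zs).
Proof.
elim: zs => //= z' zs IH /andP[/allP lt_z' pw]; case: (ltgtP z z') => [lt_zz'|lt_z'z|->] /=.
- rewrite lt_zz' pw !andbT; apply/andP; split; apply/allP => // y /lt_z'.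
  exact: lt_trans.
- rewrite IH // andbT; apply/allP => y; rewrite mem_zins => /orP[/eqP-> //|].
  exact: lt_z'.
- by rewrite pw andbT; apply/allP.
Qed.

Lemma group_rcons (R : realType) (s : seq R) (p : R) (z : int) :
  group (rcons s p) z = if clog2 p == z then rcons (group s z) p else group s z.
Proof. by rewrite /group filter_rcons. Qed.

Lemma quad_of_rcons (R : realType) N (s : seq R) (p : R) (z : int) :
  z != clog2 p -> quad_of N (rcons s p) z = quad_of N s z.
Proof. by rewrite /quad_of group_rcons eq_sym => /negPf->. Qed.

(** Reading p changes only the group of exponent [clog2 p]. A single insertion, whether it replaces
    a quadruple or adds one, therefore turns the model of [s] into that of [rcons s p]. *)
Lemma ins_quad_of (R : realType) N (s : seq R) (p : R) (zs : seq int) :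
  pairwise <%R zs ->
  ins (quad_of N (rcons s p) (clog2 p)) (map (quad_of N s) zs)
  = map (quad_of N (rcons s p)) (zins (clog2 p) zs).
Proof.
elim: zs => //= z zs IH /andP[/allP lt_z pw]; rewrite eq_exp2z lt_exp2z.
have tail y : clog2 p <= y -> all (> y) zs ->
    map (quad_of N (rcons s p)) zs = map (quad_of N s) zs.
  move=> le_y /allP gt_y; apply/eq_in_map => x /gt_y lt_yx.
  by rewrite quad_of_rcons // gt_eqF // (le_lt_trans le_y lt_yx).
case: (ltgtP (clog2 p) z) => [lt_pz|lt_zp|eq_pz] /=.
- by rewrite (tail z) ?(ltW lt_pz) // ?[in RHS](@quad_of_rcons _ _ _ _ z) ?gt_eqF //; apply/allP.
- by rewrite IH // (@quad_of_rcons _ _ _ _ z) // lt_eqF.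
- by rewrite (tail z) ?eq_pz //; apply/allP.
Qed.

Lemma lookup_quad_of (R : realType) N (s : seq R) (z : int) (zs : seq int) :
  lookup (2 ^ z) (map (quad_of N s) zs)
  = if z \in zs then Some (quad_of N s z) else None.
Proof.
elim: zs => //= z' zs ->; rewrite eq_exp2z inE.
by case: eqP => [->|].
Qed.

Lemma key_sorted_quad_of (R : realType) N (s : seq R) (zs : seq int) :
  pairwise <%R zs -> key_sorted (map (quad_of N s) zs).
Proof.
by rewrite /key_sorted !pairwise_map; apply: sub_pairwise => x y /=; rewrite lt_exp2z.
Qed.

Lemma sum_pred1_uniq (R : realType) (zs : seq int) (Q : pred int) (c : int) (x : R) :
  uniq zs ->
  \sum_(z <- zs | Q z && (c == z)) x = if Q c && (c \in zs) then x else 0.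
Proof.
elim: zs => [|z zs IH] /=; first by rewrite big_nil andbF.
case/andP=> zzs /IH{}IH; rewrite big_cons IH inE; case: eqVneq => [->|_] /=.
  by rewrite (negPf zzs) !andbF andbT; case: ifP; rewrite ?addr0.
by rewrite andbF.
Qed.

Lemma sum_groups (R : realType) (s : seq R) (zs : seq int) (Q : pred int) :
  uniq zs ->
  \sum_(z <- zs | Q z) \sum_(x <- group s z) x
  = \sum_(x <- s | Q (clog2 x) && (clog2 x \in zs)) x.
Proof.
move=> uzs; under eq_bigr do rewrite /group big_filter.
rewrite (exchange_big_dep xpredT) //= [RHS]big_mkcond /=.
by apply: eq_bigr => x _; apply: sum_pred1_uniq.
Qed.

(** Since [zs] increases, deleting minima until a key exceeds [2 ^ q'] removes exactly the groups to
    be purged. The fuel exceeds the number of groups, so the loop ends by its own test. *)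
Lemma bt_purge_quad_of (R : realType) N (s : seq R) (zs : seq int) f q' t acc :
  pairwise <%R zs -> quads t = map (quad_of N s) zs -> (size zs < f)%N ->
  let r := result (bt_purge f (2 ^ q') t acc) in
  quads r.1 = map (quad_of N s) [seq z <- zs | q' < z] /\
  r.2 = acc + \sum_(z <- zs | z <= q') \sum_(x <- group s z) x.
Proof.
elim: f zs t acc => // f IH zs t acc /= pw Et lt_f.
have := quads_bt_del_min t; rewrite Et.
case: (result _) => [[x u]|]; case: zs pw Et lt_f => //=; last first.
  by move=> _ Et _ _; rewrite big_nil addr0.
move=> z zs /andP[/allP lt_z pw] Et lt_f [<- Eu] /=.
rewrite le_exp2z big_cons ltNge; case: (leP z q') => [le_zq|lt_qz] /=.
  by have [-> ->] := IH zs (shrunk_tree u) (acc + \sum_(x <- group s z) x) pw (esym Eu) lt_f;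
     rewrite addrA.
have gt_q y : y \in zs -> q' < y by move/lt_z; apply: lt_trans.
rewrite big1_seq ?addr0; last by move=> y /andP[le_yq /gt_q]; rewrite ltNge le_yq.
by have /all_filterP-> : all (fun y => q' < y) zs by apply/allP.
Qed.

Lemma sum_rcons_cond (R : realType) (s : seq R) (p : R) (Q : pred R) :
  \sum_(x <- rcons s p | Q x) x
  = \sum_(x <- s | Q x) x + (if Q p then p else 0).
Proof. by rewrite -cats1 big_cat /= big_cons big_nil; case: ifP; rewrite ?addr0. Qed.

(** * The invariant of the pass and its preservation by one step *)

Section Pass.
Variables (R : realType) (prm : params R).
Hypothesis N0_gt0 : (0 < N0 prm)%N.
Local Notation G := (gamma0 prm)%:Z.
Local Notation N := (N0 prm).

(* [zs] lists the exponents z of the keys 2^z in the tree. *)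
Definition state_ok (s : seq R) (st : state R) (q : int) (zs : seq int) : Prop :=
  [/\ st_q st = Some q, pairwise <%R zs,
      forall z, (z \in zs) = (q < z) && has (fun x => clog2 x == z) s,
      quads (st_tree st) = map (quad_of N s) zs
    & st_small st = \sum_(x <- s | clog2 x <= q) x /\
      forall x, x \in s -> clog2 x <= q + G + 1].

Lemma pairwise_uniq_int (zs : seq int) : pairwise <%R zs -> uniq zs.
Proof. by rewrite -lt_sorted_pairwise; apply: lt_sorted_uniq. Qed.

(** Shared by the first job after q0 = -oo and by a job above the top group. Hence [zs] need only be
    right above the new threshold, and the last premise says that P_(-1) is correct once the purged
    totals are added. *)
Lemma rebase_ok (s : seq R) (st : state R) (p : R) (q' : int) (zs : seq int) :
  0 < p -> q' = clog2 p - G - 1 -> pairwise <%R zs ->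
  (forall x, x \in s -> clog2 x < clog2 p) ->
  (forall z, q' < z -> (z \in zs) = has (fun x => clog2 x == z) s) ->
  quads (st_tree st) = map (quad_of N s) zs ->
  st_small st + \sum_(z <- zs | z <= q') \sum_(x <- group s z) x
    = \sum_(x <- s | clog2 x <= q') x ->
  exists zs', state_ok (rcons s p) (result (rebase prm st p)) q' zs'.
Proof.
move=> p0 q'E pw lt_p mem_zs Et small_eq; rewrite /rebase /= -q'E.
have -> : q' + G + 1 = clog2 p by rewrite q'E; lia.
have lt_q'p : q' < clog2 p by rewrite q'E; lia.
have lt_f : (size zs < (size (quads (st_tree st))).+1)%N by rewrite Et size_map.
have [Eq Ea] := bt_purge_quad_of q' (st_small st) pw Et lt_f.
set r := result (bt_purge _ _ _ _) in Eq Ea *.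
exists (zins (clog2 p) [seq z <- zs | q' < z]).
have pwf : pairwise <%R [seq z <- zs | q' < z] by apply: pairwise_filter.
(* The job p opens a new top group, so the inserted singleton is its complete quadruple. *)
have group0 : group s (clog2 p) = [::].
  apply/eqP; rewrite -[_ == _]negbK -has_filter; apply/hasPn => x /lt_p.
  by move=> /lt_eqF ->.
split=> //=; first exact: pairwise_zins.
- move=> z; rewrite mem_zins mem_filter has_rcons eq_sym.
  case: eqP => [<-|_] /=; first by rewrite lt_q'p.
  by case: ltP => //= /mem_zs.
- rewrite quads_bt_put Eq ?key_sorted_quad_of // -ins_quad_of //.
  by congr ins; rewrite /quad_of group_rcons eqxx group0 /= big_seq1 N0_gt0.
- split; first by rewrite Ea small_eq sum_rcons_cond leNgt lt_q'p addr0.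
  by move=> x; rewrite mem_rcons inE => /orP[/eqP->|/lt_p]; lia.
Qed.

Lemma alg3_step_ok (s : seq R) (st : state R) (p : R) (q : int) (zs : seq int) :
  (forall x, x \in s -> 0 < x) -> 0 < p -> state_ok s st q zs ->
  exists q' zs', state_ok (rcons s p) (result (alg3_step prm st p)) q' zs' /\
    (q' = q \/ q' = clog2 p - G - 1).
Proof.
move=> s0 p0 [Eq pw mem_zs Et [Es hi]]; rewrite /alg3_step Eq /=.
have -> : clog2 p - q - 1 + q + 1 = clog2 p by lia.
have ks := key_sorted_quad_of N s pw.
rewrite bt_find_lookup ?Et // lookup_quad_of.
have small_rcons : q < clog2 p ->
    st_small st = \sum_(x <- rcons s p | clog2 x <= q) x.
  by move=> lt_qp; rewrite sum_rcons_cond leNgt lt_qp addr0.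
have ins_ok (a : quad R) : q < clog2 p -> clog2 p <= q + G + 1 ->
    a = quad_of N (rcons s p) (clog2 p) ->
    state_ok (rcons s p) (State (Some q) (st_small st)
      (result (bt_put a (st_tree st)))) q (zins (clog2 p) zs).
  move=> lt_qp le_p ->; split=> //=; first exact: pairwise_zins.
  - move=> z; rewrite mem_zins mem_zs has_rcons eq_sym.
    by case: eqP => [<-|_] //=; rewrite lt_qp.
  - by rewrite quads_bt_put Et // ins_quad_of.
  - split; first exact: small_rcons.
    by move=> x; rewrite mem_rcons inE => /orP[/eqP->|/hi].
case: ifP => [zs_p|zs_p] /=.
  move: (zs_p); rewrite mem_zs => /andP[lt_qp /hasP[x xs /eqP xp]].
  exists q, (zins (clog2 p) zs); split; last by left.
  apply: ins_ok => //; first by rewrite -xp hi.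
  rewrite /quad_of group_rcons eqxx size_rcons -cats1 big_cat big_seq1 /=.
  (* If the count including p is within the threshold, so was the previous count; the old list was
     therefore still complete. *)
  congr Quad; case: ifP => // lt_N; by rewrite (ltnW lt_N) rev_cat.
rewrite -clog2_le //; case: (leP (clog2 p) q) => [le_pq|lt_qp] /=.
  exists q, zs; split; last by left.
  split=> //=; first last.
  - split; first by rewrite sum_rcons_cond le_pq Es.
    move=> x; rewrite mem_rcons inE => /orP[/eqP->|/hi //]; lia.
  - rewrite Et; apply/eq_in_map => z; rewrite mem_zs => /andP[lt_qz _].
    by rewrite quad_of_rcons // gt_eqF // (le_lt_trans le_pq).
  - move=> z; rewrite mem_zs has_rcons; case: ltP => //= lt_qz.
    by rewrite lt_eqF // (le_lt_trans le_pq).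
rewrite -clog2_le //; case: (leP (clog2 p) (q + G + 1)) => [le_p|lt_p] /=.
  exists q, (zins (clog2 p) zs); split; last by left.
  have g0 : group s (clog2 p) = [::].
    move: zs_p; rewrite mem_zs lt_qp /= => /negbT; rewrite has_filter negbK.
    by move/eqP.
  apply: ins_ok => //; rewrite /quad_of group_rcons eqxx g0 /= big_seq1.
  by rewrite N0_gt0.
have [|||||zs' ok] := @rebase_ok s st p _ zs p0 erefl.
- exact: pw.
- by move=> x /hi /le_lt_trans; apply.
- by move=> z lt_z; rewrite mem_zs (_ : q < z) //; lia.
- exact: Et.
(* Job by job: an exponent at most q is already counted in P_(-1), and one in (q, q'] belongs to a
   purged group. The two cases are disjoint, and q <= q' because p overflows the top group. *)
- rewrite Es sum_groups ?pairwise_uniq_int // big_mkcond [X in _ + X]big_mkcond.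
  rewrite -big_split /= [RHS]big_mkcond [LHS]big_seq [RHS]big_seq.
  apply: eq_bigr => x xs; rewrite mem_zs.
  have -> : has (fun y => clog2 y == clog2 x) s by apply/hasP; exists x.
  case: leP => [le_xq|lt_qx] /=; rewrite ?andbF ?addr0 ?andbT ?add0r //.
  by rewrite ifT //; lia.
- by exists (clog2 p - G - 1), zs'; split; last right.
Qed.

Lemma sa_state_rcons (X St V : Type) (alg : stream_alg X St V) s x :
  sa_state alg (rcons s x) = result (sa_step alg (sa_state alg s) x).
Proof. by rewrite /sa_state -cats1 foldl_cat. Qed.

(** The last clause records the origin of the threshold: unless q is the initial value, some job x
    already read has q = [clog2 x] - G - 1, whence 2^(q+G) < x. This is the large job that the
    approximation factor requires. *)
Lemma alg3_state_ok (q_init : option int) (Ms : seq (machine R)) (s : seq R) :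
  (forall x, x \in s -> 0 < x) ->
  let st := sa_state (alg3 prm q_init Ms) s in
  (st = State None 0 Leaf /\ q_init = None /\ s = [::]) \/
  exists q zs, state_ok s st q zs /\
    (q_init = Some q \/ exists2 x, x \in s & q = clog2 x - G - 1).
Proof.
elim/last_ind: s => [_|s p IH pos].
  rewrite /sa_state /=; case: q_init => [q|]; last by left.
  right; exists q, [::]; split; last by left.
  by split=> //= [z|]; [rewrite andbF | rewrite big_nil].
have p0 : 0 < p by apply: pos; rewrite mem_rcons mem_head.
have s0 x : x \in s -> 0 < x by move=> xs; apply: pos; rewrite mem_rcons inE xs orbT.
rewrite sa_state_rcons /=; case: (IH s0) => [[-> [-> s_nil]]|[q [zs [ok src]]]]; right.
  rewrite /alg3_step /= s_nil.
  have [|||||zs' ok] := @rebase_ok [::] (State None 0 Leaf) p _ [::] p0 erefl => //.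
    by rewrite !big_nil addr0.
  exists (clog2 p - G - 1), zs'; split => //; right.
  by exists p; rewrite ?mem_head.
have [q' [zs' [ok' src']]] := alg3_step_ok s0 p0 ok.
exists q', zs'; split=> //; case: src' => ->.
  case: src => [->|[x xs ->]]; [by left | right].
  by exists x => //; rewrite mem_rcons inE xs orbT.
by right; exists p; rewrite ?mem_rcons ?mem_head.
Qed.

End Pass.

(** * Processing available on a machine *)

Lemma avail_from_start (R : realType) (a e : R) s :
  path <%R a [seq x.1 | x <- s] -> avail_from a e s a = 0.
Proof.
by case: s => [|[b e'] s] /=; rewrite ?subrr ?mul0r // => /andP[/ltW -> _].
Qed.

(** Source of all estimates on A_i: a positive lower rate gives strict monotonicity, the rate e0
    bounds the delay caused by overflowing jobs, and the upper rate 1 gives A_i(t) <= t. *)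
Lemma avail_from_lip (R : realType) (lo hi a e : R) s (t t' : R) :
  path <%R a [seq x.1 | x <- s] ->
  (forall r, r \in e :: [seq x.2 | x <- s] -> lo <= r <= hi) -> t <= t' ->
  lo * (t' - t) <= avail_from a e s t' - avail_from a e s t <= hi * (t' - t).
Proof.
elim: s a e t t' => [|[b e'] s IH] a e t t' /=.
  move=> _ rng tt'; have /andP[le_e ge_e] := rng e (mem_head _ _).
  have -> : (t' - a) * e - (t - a) * e = e * (t' - t) by ring.
  by rewrite !ler_wpM2r ?subr_ge0.
case/andP=> lt_ab pth rng tt'; have /andP[le_e ge_e] := rng e (mem_head _ _).
have {}IH x x' : x <= x' -> lo * (x' - x)
    <= avail_from b e' s x' - avail_from b e' s x <= hi * (x' - x).
  by apply: IH => // r rs; apply: rng; rewrite inE rs orbT.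
case: (leP t b) => [tb|bt]; case: (leP t' b) => [t'b|bt'].
- have -> : (t' - a) * e - (t - a) * e = e * (t' - t) by ring.
  by rewrite !ler_wpM2r ?subr_ge0.
- have /andP[] := IH _ _ (ltW bt'); rewrite avail_from_start // subr0 => H1 H2.
  have -> : (b - a) * e + avail_from b e' s t' - (t - a) * e
            = e * (b - t) + avail_from b e' s t' by ring.
  have splitE c : c * (t' - t) = c * (b - t) + c * (t' - b) by ring.
  by rewrite !splitE !lerD // ler_wpM2r // subr_ge0.
- by have := le_lt_trans tt' (le_lt_trans t'b bt); rewrite ltxx.
- by rewrite opprD addrACA subrr add0r; apply: IH.
Qed.

Lemma avail0 (R : realType) (M : machine R) : valid_machine M -> avail M 0 = 0.
Proof. by case=> pth _; apply: avail_from_start. Qed.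

Lemma avail_lip_le (R : realType) (M : machine R) (lo t t' : R) :
  valid_machine M -> (forall r, r \in ratios M -> lo <= r) -> t <= t' ->
  lo * (t' - t) <= avail M t' - avail M t.
Proof.
case=> pth rng lo_le tt'.
suff: lo * (t' - t) <= avail M t' - avail M t <= 1 * (t' - t) by case/andP.
by apply: avail_from_lip => // r rM; rewrite lo_le //; case/andP: (rng _ rM).
Qed.

Lemma avail_lip_ge (R : realType) (M : machine R) (t t' : R) :
  valid_machine M -> t <= t' -> avail M t' - avail M t <= t' - t.
Proof.
case=> pth rng tt'.
suff: 0 * (t' - t) <= avail M t' - avail M t <= 1 * (t' - t).
  by case/andP; rewrite mul1r.
by apply: avail_from_lip => // r rM; case/andP: (rng _ rM) => /ltW -> ->.
Qed.

Lemma avail_le (R : realType) (M : machine R) (t : R) :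
  valid_machine M -> 0 <= t -> avail M t <= t.
Proof. by move=> vM t0; have := avail_lip_ge vM t0; rewrite avail0 // !subr0. Qed.

Lemma min_ratio (R : realType) (s : seq R) :
  (forall r, r \in s -> 0 < r) -> exists2 lo : R, 0 < lo & forall r, r \in s -> lo <= r.
Proof.
elim: s => [|r s IH] pos; first by exists 1.
have [x xs|lo lo0 lo_le] := IH; first by apply: pos; rewrite inE xs orbT.
exists (Num.min r lo) => [|x]; first by rewrite lt_min lo0 pos ?mem_head.
by rewrite inE => /orP[/eqP->|/lo_le]; rewrite ge_min ?lexx // => ->; rewrite orbT.
Qed.

Lemma le_avail (R : realType) (M : machine R) :
  valid_machine M -> {mono avail M : t t' / t <= t'}.
Proof.
move=> vM; apply: le_mono => t t' tt'.
have [r /(proj2 vM)/andP[]//|lo lo0 lo_le] := @min_ratio _ (ratios M).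
rewrite -subr_gt0 (lt_le_trans _ (avail_lip_le vM lo_le (ltW tt'))) //.
by rewrite mulr_gt0 // subr_gt0.
Qed.

Lemma avail_from_onto (R : realType) (a e : R) s (L : R) :
  path <%R a [seq x.1 | x <- s] ->
  (forall r, r \in e :: [seq x.2 | x <- s] -> 0 < r) ->
  0 <= L -> exists2 t, a <= t & avail_from a e s t = L.
Proof.
elim: s a e L => [|[b e'] s IH] a e L /= pth pos L0; have e0 := pos e (mem_head _ _).
  exists (a + L / e); first by rewrite lerDl divr_ge0 // ltW.
  by rewrite addrC addKr divfK // gt_eqF.
case/andP: pth => ab pth; case: (leP L ((b - a) * e)) => [le_L|lt_L].
  exists (a + L / e); first by rewrite lerDl divr_ge0 // ltW.
  rewrite ifT; last by rewrite -lerBrDl ler_pdivrMr.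
  by rewrite addrC addKr divfK // gt_eqF.
have [||t bt Et] := IH b e' (L - (b - a) * e) pth.
- by move=> r rs; apply: pos; rewrite inE rs orbT.
- by rewrite subr_ge0 ltW.
(* Strictness matters: at t = b the test [t <= b] selects the first piece. Equality would give
   [avail_from] value 0, whereas the remaining amount is positive. *)
have {bt}: b < t.
  rewrite lt_neqAle bt andbT; apply/eqP => Eb.
  by move: Et; rewrite -Eb avail_from_start // => /esym/eqP; rewrite subr_eq0 gt_eqF.
move=> bt; exists t; first by rewrite ltW // (lt_trans ab).
by rewrite leNgt bt /= Et addrC subrK.
Qed.

Lemma avail_onto (R : realType) (M : machine R) (L : R) :
  valid_machine M -> 0 <= L -> exists2 t, 0 <= t & avail M t = L.
Proof.
by case=> pth rng; apply: avail_from_onto => // r /rng/andP[].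
Qed.

(** * Correctness of the tables, of their evaluation and of the test of (a) and (b) *)

Fixpoint table (R : realType) (T A e : R) (s : seq (R * R)) : seq (R * R * R) :=
  (T, A, e) :: if s is (b, e') :: s' then table b (A + (b - T) * e) e' s' else [::].

Lemma mk_tableE (R : realType) (T A e : R) s :
  result (mk_table T A e s) = table T A e s.
Proof. by elim: s T A e => [|[b e'] s IH] T A e //=; rewrite IH. Qed.

Lemma size_table (R : realType) (T A e : R) s : size (table T A e s) = (size s).+1.
Proof. by elim: s T A e => [|[b e'] s IH] T A e //=; rewrite IH. Qed.

Definition machine_table (R : realType) (M : machine R) : seq (R * R * R) :=
  table 0 0 (ratio1 M) (later M).

Lemma mk_tablesE (R : realType) (Ms : seq (machine R)) :
  result (mk_tables Ms) = map (@machine_table R) Ms.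
Proof. by elim: Ms => //= M Ms ->; rewrite mk_tableE. Qed.

Lemma size_machine_table (R : realType) (M : machine R) :
  size (machine_table M) = n_intervals M.
Proof. by rewrite size_table /n_intervals /= size_map. Qed.

Lemma table_ge (R : realType) (T A e : R) s k :
  path <%R T [seq x.1 | x <- s] -> (k < (size s).+1)%N ->
  T <= (nth (0, 0, 0) (table T A e s) k).1.1.
Proof.
elim: s T A e k => [|[b e'] s IH] T A e [|k] //= /andP[Tb pth] lt_k.
exact: le_trans (ltW Tb) (IH _ _ _ _ pth lt_k).
Qed.

Lemma table_avail_from (R : realType) (T A e t : R) s k :
  let tb := table T A e s in let x := nth (0, 0, 0) tb k in
  path <%R T [seq x.1 | x <- s] -> (k < size tb)%N -> x.1.1 <= t ->
  ((k.+1 < size tb)%N -> t < (nth (0, 0, 0) tb k.+1).1.1) ->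
  x.1.2 + (t - x.1.1) * x.2 = A + avail_from T e s t.
Proof.
elim: s T A e k => [|[b e'] s IH] T A e [|k] //=.
  case: s {IH} => [|[b2 e2] s] /= /andP[Tb _] _ _ /(_ isT) tb; by rewrite ltW.
case/andP=> Tb pth lt_k le_t gt_t.
have le_bt : b <= t.
  by apply: le_trans le_t; apply: table_ge => //; rewrite size_table in lt_k.
(* At the breakpoint t = b the table uses the later interval and [avail_from] the earlier one; the
   values agree by continuity. *)
rewrite IH //; case: leP => [le_tb|_]; last by rewrite addrA.
have -> : t = b by apply/eqP; rewrite eq_le le_tb.
by rewrite avail_from_start // addr0.
Qed.

(** The premises are the loop invariant: T_lo <= t < T_(lo+len), where reaching the end of the table
    counts as +oo. Each round shortens the window, so fuel [len] suffices. *)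
Lemma locateP (R : realType) f (tb : seq (R * R * R)) lo len t :
  (0 < len <= f)%N -> (lo + len <= size tb)%N ->
  (nth (0, 0, 0) tb lo).1.1 <= t ->
  ((lo + len < size tb)%N -> t < (nth (0, 0, 0) tb (lo + len)).1.1) ->
  let k := result (locate f tb lo len t) in
  [/\ (k < size tb)%N, (nth (0, 0, 0) tb k).1.1 <= t
    & (k.+1 < size tb)%N -> t < (nth (0, 0, 0) tb k.+1).1.1].
Proof.
elim: f lo len => [|f IH] lo len; first by case: len.
move=> /andP[len0 len_f] le_sz le_t lt_t /=.
case: (leqP len 1) => [len1|len1] /=.
  have E : len = 1%N by apply/eqP; rewrite eqn_leq len1.
  by move: le_sz lt_t; rewrite E addn1.
have h0 : (0 < len./2)%N by case: len len1 {len0 len_f le_sz lt_t} => [|[]].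
have h1 : (len./2 < len)%N by rewrite -divn2 ltn_Pdiv.
case: ifP => [d|/negbT d] /=; apply: IH => //.
- by rewrite subn_gt0 h1 leq_subLR; lia.
- by rewrite -addnA subnKC // ltnW.
- by rewrite -addnA subnKC // ltnW.
- by rewrite h0; lia.
- by lia.
- by move=> _; rewrite ltNge.
Qed.

Lemma eval_tableE (R : realType) (M : machine R) (t : R) :
  valid_machine M -> 0 <= t ->
  result (eval_table (machine_table M) t) = avail M t.
Proof.
move=> [pth _] t0; rewrite /eval_table /=.
have sz : (0 < size (machine_table M))%N by rewrite size_table.
have [||||lt_k le_t gt_t] :=
  @locateP _ (size (machine_table M)) (machine_table M) 0 (size (machine_table M)) t.
- by rewrite sz leqnn.
- by [].
- by rewrite /machine_table; case: (later M) => [|[]].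
- by rewrite add0n ltnn.
by rewrite (table_avail_from pth lt_k le_t gt_t) add0r.
Qed.

Lemma testE (R : realType) (Ms : seq (machine R)) (loads : seq R) (P t acc : R) :
  (forall i, (i < size Ms)%N -> valid_machine (nth (Machine 0 [::]) Ms i)) ->
  size loads = size Ms -> 0 <= t ->
  result (test (map (@machine_table R) Ms) loads P t acc)
  = all (fun x => x.2 <= avail x.1 t) (zip Ms loads)
    && (P <= acc + \sum_(M <- Ms) avail M t).
Proof.
elim: Ms loads acc => [|M Ms IH] [|ld loads] acc //= vM; first by rewrite big_nil addr0.
move=> [sz] t0; have /= -> := eval_tableE (vM 0%N isT) t0.
case: ifP => //= _; rewrite IH //; last by move=> i; apply: (vM i.+1).
by rewrite big_cons addrA.
Qed.

(** * The search over the assignments of the large jobs *)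

Lemma squaresE (R : realType) h (g : R) acc :
  result (squares h g acc) = [seq g ^+ (2 ^ i) | i <- rev (iota 0 h)] ++ acc.
Proof.
elim: h g acc => //= h IH g acc; rewrite IH.
rewrite rev_cons map_rcons cat_rcons -[1%N]/(1 + 0)%N iotaDl -map_rev -map_comp /=.
congr (_ ++ _); apply: eq_map => i /=.
by rewrite -expr2 -exprM expnS.
Qed.

(** The bits of x are fixed from the highest down, and [F] fails at the current left end. A
    successful probe is the right end of the remaining window; without any, all bits of x are ones,
    hence the second alternative. *)
Lemma bsearchP (R : realType) tbs (loads : seq R) (P g t : R) h :
  let F x := result (test tbs loads P x 0) in
  ~~ F t ->
  exists x, [/\ (x < 2 ^ h)%N,
    result (bsearch tbs loads P [seq g ^+ (2 ^ i) | i <- rev (iota 0 h)] t) = t * g ^+ x,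
    ~~ F (t * g ^+ x) & F (t * g ^+ x.+1) \/ x.+1 = (2 ^ h)%N].
Proof.
move=> F; elim: h t => [|h IH] t Ft.
  by exists 0%N; rewrite /= expr0 mulr1 Ft; split=> //; right.
have -> : rev (iota 0 h.+1) = h :: rev (iota 0 h) by rewrite -addn1 iotaD rev_cat.
rewrite /=; case: ifP => [Ft'|/negbT Ft'].
  have [x [lt_x Ex Fx alt]] := IH t Ft; exists x; split=> //.
    by rewrite expnS; lia.
  by left; case: alt => // ->.
have [x [lt_x Ex Fx alt]] := IH _ Ft'; exists (2 ^ h + x)%N.
rewrite -addnS !exprD !mulrA; split=> //; first by rewrite expnS; lia.
by case: alt => [|->]; [left | right; rewrite expnS; lia].
Qed.

(** Minimum with [None] as +oo. *)
Definition omin (R : realType) (b c : option R) : option R :=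
  if b is Some x then if c is Some y then Some (Num.min x y) else b else c.

Lemma try_assignmentE (R : realType) (prm : params R) tbs P gs asg best :
  result (try_assignment prm tbs P gs asg best)
  = omin best (result (try_assignment prm tbs P gs asg None)).
Proof.
by rewrite /try_assignment /=; case: ifP => _ /=; case: best.
Qed.

Fixpoint all_asg (R : realType) (m : nat) (js : seq R) (asg : seq (nat * R)) :
    seq (seq (nat * R)) :=
  if js is p :: js' then
    flatten [seq all_asg m js' ((i, p) :: asg) | i <- iota 0 m]
  else [:: asg].

Lemma enum_assignmentsE (R : realType) (prm : params R) tbs P gs js asg best :
  result (enum_assignments prm tbs P gs js asg best)
  = foldl (fun b a => omin b (result (try_assignment prm tbs P gs a None))) best
      (all_asg (pm prm) js asg).
Proof.
elim: js asg best => [|p js IH] asg best; first by rewrite /= -try_assignmentE.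
rewrite [all_asg _ _ _]/=.
rewrite [enum_assignments _ _ _ _ _ _ _]/=.
elim: (iota 0 (pm prm)) best => //= i idx IHidx best.
by rewrite foldl_cat -IH IHidx.
Qed.

Lemma foldl_omin_some (R : realType) (T : eqType) (F : T -> option R) (s : seq T) b0 b :
  foldl (fun b a => omin b (F a)) b0 s = Some b ->
  b0 = Some b \/ exists2 a, a \in s & F a = Some b.
Proof.
elim: s b0 => [|a s IH] b0 /=; first by left.
case/IH => [|[x xs Fx]]; last by right; exists x; rewrite ?inE ?xs ?orbT.
case: b0 => [x|] /=; last by right; exists a; rewrite ?mem_head.
case Fa: (F a) => [y|]; last by left.
by rewrite minEle; case: ifP => _ E; [left | right; exists a; rewrite ?mem_head ?Fa].
Qed.

Lemma foldl_omin_le0 (R : realType) (T : eqType) (F : T -> option R) (s : seq T) c :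
  exists2 b, foldl (fun b a => omin b (F a)) (Some c) s = Some b & b <= c.
Proof.
elim: s c => [|a s IH] c /=; first by exists c.
case: (F a) => [y|] /=; last exact: IH.
by have [b -> le_b] := IH (Num.min c y); exists b => //; rewrite (le_trans le_b) // ge_min lexx.
Qed.

Lemma foldl_omin_le (R : realType) (T : eqType) (F : T -> option R) (s : seq T) b0 a c :
  a \in s -> F a = Some c ->
  exists2 b, foldl (fun b a => omin b (F a)) b0 s = Some b & b <= c.
Proof.
move=> + Fa; elim: s b0 => //= x s IH b0; rewrite inE => /orP[/eqP<-|/IH//].
rewrite Fa; case: b0 => [d|] /=; last exact: foldl_omin_le0.
have [b -> le_b] := foldl_omin_le0 F s (Num.min d c); exists b => //.
by rewrite (le_trans le_b) // ge_min lexx orbT.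
Qed.

(** Assignments are functions on job indices, because equal processing times may go to different
    machines. Uniqueness of the indices allows the function to be changed at one job without
    disturbing the others. *)
Lemma all_asgP (R : realType) (T : eqType) (w : T -> R) (m : nat) (J : seq T)
    asg0 asg :
  uniq J ->
  reflect (exists2 f : T -> nat, (forall j, j \in J -> (f j < m)%N)
             & asg = rev [seq (f j, w j) | j <- J] ++ asg0)
    (asg \in all_asg m (map w J) asg0).
Proof.
elim: J asg0 => [|j J IH] asg0 /=.
  move=> _; rewrite inE; apply: (iffP eqP) => [->|[]//].
  by exists (fun=> 0%N).
case/andP=> jJ uJ; apply: (iffP flatten_mapP).
  case=> i; rewrite mem_iota add0n => /= lt_im /(IH _ uJ)[f lt_f ->].
  exists (fun x => if x == j then i else f x) => [x|].
    by rewrite inE; case: eqP => //= _ /lt_f.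
  rewrite eqxx rev_cons cat_rcons; congr (rev _ ++ _).
  by apply/eq_in_map => x xJ; case: eqP => // xj; rewrite -xj xJ in jJ.
case=> f lt_f asgE; exists (f j); first by rewrite mem_iota add0n /= lt_f ?mem_head.
apply/(IH _ uJ); exists f; last by rewrite asgE /= rev_cons cat_rcons.
by move=> x xJ; apply: lt_f; rewrite inE xJ orbT.
Qed.

Lemma load_ofE (R : realType) i (asg : seq (nat * R)) acc :
  result (load_of i asg acc) = acc + \sum_(x <- asg | x.1 == i) x.2.
Proof.
elim: asg acc => [|[i' p] asg IH] acc /=; first by rewrite big_nil addr0.
by rewrite IH big_cons /=; case: ifP; rewrite ?addrA.
Qed.

Lemma loads_ofE (R : realType) (idx : seq nat) (asg : seq (nat * R)) :
  result (loads_of idx asg) = [seq \sum_(x <- asg | x.1 == i) x.2 | i <- idx].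
Proof. by elim: idx => //= i idx ->; rewrite load_ofE add0r. Qed.

Lemma totalE (R : realType) (qs : seq (quad R)) acc :
  result (Defs.total qs acc) = acc + \sum_(a <- qs) tot a.
Proof.
elim: qs acc => [|a qs IH] acc /=; first by rewrite big_nil addr0.
by rewrite IH big_cons addrA.
Qed.

Lemma appendE (A : Type) (s1 s2 : seq A) : result (append s1 s2) = s1 ++ s2.
Proof. by elim: s1 => //= x s1 ->. Qed.

Lemma large_jobsE (R : realType) (kL : R) (qs : seq (quad R)) :
  result (large_jobs kL qs) = flatten [seq jobs a | a <- qs & kL < key a].
Proof. by elim: qs => //= a qs ->; case: ifP => //= _; rewrite appendE. Qed.

Lemma test_machinesE (R : realType) (m : nat) (Ms : m.-tuple (machine R))
    (L : nat -> R) (P t : R) :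
  (forall i, valid_machine (tnth Ms i)) -> 0 <= t ->
  result (test (map (@machine_table R) Ms) (map L (iota 0 m)) P t 0)
  = [forall i : 'I_m, L i <= avail (tnth Ms i) t]
    && (P <= \sum_(i < m) avail (tnth Ms i) t).
Proof.
move=> vM t0; rewrite testE ?size_map ?size_iota ?size_tuple //; last first.
  by move=> i lt_i; rewrite -(tnth_nth _ _ (Ordinal lt_i)).
rewrite add0r big_tuple; congr (_ && _).
pose M0 : machine R := Machine 0 [::].
have sz : size (zip Ms (map L (iota 0 m))) = m.
  by rewrite size_zip size_map size_iota size_tuple minnn.
have nthE (i : 'I_m) : nth (M0, 0) (zip Ms (map L (iota 0 m))) i = (tnth Ms i, L i).
  rewrite nth_zip ?size_map ?size_iota ?size_tuple //.
  by rewrite (nth_map 0%N) ?size_iota // nth_iota // add0n -tnth_nth.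
apply/(all_nthP (M0, 0))/forallP => [H i|H i].
  by have := H i; rewrite nthE sz ltn_ord; apply.
by rewrite sz => lt_i; rewrite (nthE (Ordinal lt_i)); apply: H.
Qed.

(** * Packing and scheduling *)

Lemma longest_prefix (R : realType) (T : Type) (w : T -> R) (s : seq T) (a : R) :
  0 <= a ->
  exists s1 s2, [/\ s = s1 ++ s2, \sum_(x <- s1) w x <= a
    & s2 = [::] \/ exists y s3, s2 = y :: s3 /\ a < \sum_(x <- s1) w x + w y].
Proof.
elim: s a => [|x s IH] a a0.
  by exists [::], [::]; rewrite big_nil; split=> //; left.
case: (leP (w x) a) => [le_x|lt_x]; last first.
  exists [::], (x :: s); rewrite big_nil; split=> //; right.
  by exists x, s; rewrite add0r.
have [|s1 [s2 [-> le_s1 alt]]] := IH (a - w x); first by rewrite subr_ge0.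
exists (x :: s1), s2; rewrite big_cons; split=> //; first by rewrite -lerBrDl.
case: alt => [|[y [s3 [-> lt_y]]]]; [by left | right].
by exists y, s3; rewrite -addrA -ltrBlDl.
Qed.

Lemma eq_bigl_seq (R : realType) (T : eqType) (w : T -> R) (s : seq T) (P Q : pred T) :
  {in s, P =1 Q} -> \sum_(x <- s | P x) w x = \sum_(x <- s | Q x) w x.
Proof.
move=> PQ; rewrite big_seq_cond [RHS]big_seq_cond; apply: eq_bigl => x.
by case xs: (x \in s); rewrite //= PQ.
Qed.

(* Filling the bins one after the other, at most one item per bin except the last
   sticks out; such items are sent to the index [size c] or above. *)
Lemma packing (R : realType) (T : eqType) (w : T -> R) (c : seq R) (s : seq T) :
  uniq s -> (forall x, x \in s -> 0 <= w x) -> (forall a, a \in c -> 0 <= a) ->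
  c != [::] -> \sum_(x <- s) w x <= \sum_(a <- c) a ->
  exists f : T -> nat,
    (forall i, (i < size c)%N -> \sum_(x <- s | f x == i) w x <= nth 0 c i) /\
    (count (fun x => size c <= f x)%N s < size c)%N.
Proof.
elim: c s => // a c IH s us w0 c0 _ le_wc.
have a0 : 0 <= a by apply: c0; rewrite mem_head.
have c0' b : b \in c -> 0 <= b by move=> bc; apply: c0; rewrite inE bc orbT.
have [s1 [s2 [sE le_s1 [s2E|[y [s3 [s2E lt_y]]]]]]] := longest_prefix w s a0.
  rewrite s2E cats0 in sE; rewrite -{}sE in le_s1.
  exists (fun=> 0%N); split=> [[|i] lt_i|] /=; last first.
  - by rewrite (eq_count (a2 := pred0)) ?count_pred0.
  - by rewrite big_pred0 // c0' // mem_nth.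
  - by rewrite (eq_bigl xpredT).
subst s2; subst s.
move: us; rewrite cat_uniq /= => /and4P[us1 dis ys3 us3].
have ys1 : y \notin s1 by apply: contra dis => ->.
have s3s1 x : x \in s3 -> x \notin s1.
  by move=> xs3; apply: contra dis => xs1; apply/orP; right; apply/hasP; exists x.
move: le_wc; rewrite big_cat !big_cons /= => le_wc.
(* The first bin together with y exceeds its capacity, so the remaining bins have room for the
   rest. *)
have le_s3 : \sum_(x <- s3) w x <= \sum_(b <- c) b.
  by rewrite -(lerD2l a) (le_trans _ le_wc) // addrA lerD2r ltW.
have w3 x : x \in s3 -> 0 <= w x.
  by move=> xs; apply: w0; rewrite mem_cat inE xs !orbT.
(* In the last bin nothing can stick out, since the total weight is at most the total capacity; this
   gives the strict bound on the overflow count. *)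
have [c_nil|c_nnil] := eqVneq c [::].
  have := le_lt_trans le_wc; rewrite c_nil big_nil addr0 => /(_ _ lt_y).
  by rewrite addrA gtrDl ltNge big_seq sumr_ge0.
have [f [fc cnt_f]] := IH s3 us3 w3 c0' c_nnil le_s3.
(* The index [(size c).+1] is the number of bins of [a :: c], so y is marked as overflowing. *)
pose g x := if x \in s1 then 0%N else if x == y then (size c).+1 else (f x).+1.
have g1 x : x \in s1 -> g x = 0%N by rewrite /g => ->.
have gy : g y = (size c).+1 by rewrite /g (negPf ys1) eqxx.
have g3 x : x \in s3 -> g x = (f x).+1.
  move=> xs3; rewrite /g (negPf (s3s1 _ xs3)); case: eqP => // xy.
  by rewrite -xy xs3 in ys3.
exists g; split=> [i lt_i|].
  rewrite big_cat big_cons /= gy.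
  case: i lt_i => [|i] /= lt_i.
    rewrite (@eq_bigl_seq _ _ _ s1 _ xpredT) => [|x /g1-> //].
    by rewrite (@eq_bigl_seq _ _ _ s3 _ pred0) ?big_pred0_eq ?addr0 // => x /g3->.
  rewrite eqSS gtn_eqF // (@eq_bigl_seq _ _ _ s1 _ pred0) => [|x /g1-> //].
  rewrite big_pred0_eq add0r (@eq_bigl_seq _ _ _ s3 _ (fun x => f x == i)) ?fc //.
  by move=> x /g3->.
rewrite count_cat /= gy leqnn (@eq_in_count _ _ pred0 s1) => [|x /g1-> //].
rewrite count_pred0 (@eq_in_count _ _ (fun x => size c <= f x)%N s3) => [|x /g3-> //].
by rewrite add0n add1n.
Qed.

(** Round-robin distribution: each block of m1 consecutive numbers contains a given residue at most
    once. *)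
Lemma count_modn (m1 i d c : nat) :
  (d <= m1 * c)%N -> (count (fun k => k %% m1 == i) (iota 0 d) <= c)%N.
Proof.
move=> le_d; apply: (@leq_trans (count (fun k => k %% m1 == i) (iota 0 (m1 * c)))%N).
  by rewrite -(subnKC le_d) iotaD count_cat leq_addr.
elim: c {le_d} => [|c IH]; first by rewrite muln0.
rewrite mulnSr iotaD count_cat -addn1 leq_add // add0n -[(m1 * c)%N]addn0 iotaDl.
rewrite count_map (@eq_in_count _ _ (pred1 i)) => [|k].
  by rewrite count_uniq_mem ?iota_uniq // leq_b1.
by rewrite mem_iota add0n /= => lt_k; rewrite mulnC modnMDl modn_small.
Qed.

(** Each machine runs its jobs in index order. Start and end times are preimages under A_i of
    partial sums of loads, and monotonicity of A_i turns comparisons of sums into comparisons of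
    times. *)
Lemma schedule_exists (R : realType) (m : nat) (Ms : m.-tuple (machine R)) (p : seq R)
    (f : 'I_(size p) -> 'I_m) (V : R) :
  (forall i, valid_machine (tnth Ms i)) -> (forall x, x \in p -> 0 < x) -> 0 <= V ->
  (forall i, \sum_(j | f j == i) nth 0 p j <= avail (tnth Ms i) V) ->
  exists S : schedule R m (size p), feasible Ms S /\ makespan S <= V.
Proof.
move=> vM pos V0 loads.
have w0 (j : 'I_(size p)) : 0 < nth 0 p j by apply: pos; rewrite mem_nth.
pose before (j : 'I_(size p)) : R := \sum_(k | (f k == f j) && (k < j)%N) nth 0 p k.
have b0 j : 0 <= before j by apply: sumr_ge0 => k _; apply: ltW.
have : forall j, exists t, [/\ 0 <= t.1, 0 <= t.2,
    avail (tnth Ms (f j)) t.1 = before j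
    & avail (tnth Ms (f j)) t.2 = before j + nth 0 p j].
  move=> j; have [t1 t1_0 E1] := avail_onto (vM (f j)) (b0 j).
  have [|t2 t2_0 E2] := @avail_onto _ _ (before j + nth 0 p j) (vM (f j)).
    by rewrite addr_ge0 // ltW.
  by exists (t1, t2).
case/choice => t tP.
exists (Schedule f (fun j => (t j).1) (fun j => (t j).2)); split.
  split; [|split] => /=.
  - move=> j; have [t10 t20 E1 E2] := tP j; rewrite t10 /=.
    by rewrite -(le_avail (vM (f j))) E1 E2 lerDl ltW.
  - by move=> j; have [_ _ -> ->] := tP j; rewrite addrC addKr.
  - have order (j j' : 'I_(size p)) : (j < j')%N -> f j = f j' -> (t j).2 <= (t j').1.
      move=> lt_jj fE; have [_ _ _ E2] := tP j; have [_ _ E1 _] := tP j'.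
      rewrite -(le_avail (vM (f j))) E2 fE E1 /before -fE.
      rewrite [leRHS](bigD1 j) /=; last by rewrite eqxx.
      rewrite [leLHS]addrC lerD2l.
      rewrite [leRHS]big_mkcond [leLHS]big_mkcond; apply: ler_sum => k _.
      case: (f k == f j) => //=; case: (ltnP k j) => [lt_kj|_] /=;
        last by case: ifP => // _; apply/ltW/w0.
      by rewrite (ltn_trans lt_kj lt_jj) -val_eqE /= ltn_eqF.
    move=> j j' neq fE; case: (ltngtP j j') => [lt|lt|/val_inj E].
    + by left; apply: order.
    + by right; apply: order.
    + by rewrite E eqxx in neq.
apply/bigmax_leP; split=> //= j _; have [_ _ _ E2] := tP j.
rewrite -(le_avail (vM (f j))) E2; apply: le_trans (loads (f j)).
rewrite [leRHS](bigD1 j) //= [leLHS]addrC lerD2l /before.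
rewrite [leRHS]big_mkcond [leLHS]big_mkcond; apply: ler_sum => k _.
case: (f k == f j) => //=; case: (ltnP k j) => [lt_kj|_] /=;
  last by case: ifP => // _; apply/ltW/w0.
by rewrite -val_eqE /= ltn_eqF.
Qed.

(** Induction on the number of jobs: the job that starts last is removed, and all the others finish
    before its start, which takes over the role of T. *)
Lemma le_load_avail (R : realType) (m : nat) (Ms : m.-tuple (machine R)) (p : seq R)
    (S : schedule R m (size p)) (i : 'I_m) (T : R) :
  (forall i, valid_machine (tnth Ms i)) -> (forall x, x \in p -> 0 < x) ->
  feasible Ms S -> makespan S <= T ->
  \sum_(j | s_mach S j == i) nth 0 p j <= avail (tnth Ms i) T.
Proof.
move=> vM pos [se [work disj]] /bigmax_leP[T0 leT].
have w0 (j : 'I_(size p)) : 0 < nth 0 p j by apply: pos; rewrite mem_nth.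
set A := avail (tnth Ms i); have A_le := le_avail (vM i).
have workA j : s_mach S j = i -> A (s_end S j) = A (s_start S j) + nth 0 p j.
  by move=> ji; rewrite -(work j) ji addrC subrK.
have lt_se j : s_mach S j = i -> s_start S j < s_end S j.
  move=> ji; rewrite ltNge -(A_le (s_end S j)) -ltNge.
  by rewrite -/A workA // ltrDl.
pose X := [set j | s_mach S j == i]%SET.
rewrite (eq_bigl (mem X)); last by move=> j; rewrite !inE.
have : forall j, j \in X -> s_mach S j = i /\ s_end S j <= T.
  by move=> j; rewrite inE => /eqP ->; rewrite leT.
elim: {X}#|X| {-2}X (erefl #|X|) T T0 {leT} => [|n IH] X sX T T0 XP.
  rewrite (cards0_eq sX) big_set0 -(avail0 (vM i)) -/A.
  by rewrite A_le.
have /set0Pn[j0 j0X] : X != finset.set0 by rewrite -card_gt0 sX.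
case: (@arg_maxP _ _ _ j0 (mem X) (s_start S) j0X) => j jX jmax.
rewrite /= in jX jmax.
have [ji jT] := XP j jX; rewrite (bigD1 j) //= addrC.
have step : \sum_(k in (X :\ j)%SET) nth 0 p k <= A (s_start S j).
  apply: IH => [|| k].
  - by move: sX; rewrite (cardsD1 j) (_ : j \in X) // => -[].
  - by case/andP: (se j).
  - rewrite in_setD1 => /andP[kj kX]; have [ki _] := XP k kX; split=> //.
    case: (disj k j kj); rewrite ?ki ?ji // => le_jk.
    by have := lt_le_trans (lt_se j ji) (le_trans le_jk (jmax k kX)); rewrite ltxx.
apply: (@le_trans _ _ (A (s_end S j))); last by rewrite A_le.
rewrite workA // lerD2r; apply: le_trans step.
by rewrite le_eqVlt; apply/orP; left; apply/eqP/eq_bigl => k; rewrite !inE andbC.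
Qed.

(** * Correctness of the output phase *)

Lemma nceil_ge (R : realType) (x : R) : x <= (nceil x)%:R.
Proof.
apply: le_trans (ceil_ge x) _; rewrite /nceil -[leRHS]/((Posz _)%:~R) ler_int.
exact: lez_abs.
Qed.

Lemma nceil_lt (R : realType) (x : R) : 0 <= x -> (nceil x)%:R < x + 1.
Proof.
move=> x0; rewrite /nceil -[ltLHS]/((Posz _)%:~R) gez0_abs; last first.
  by rewrite ceil_ge0 (lt_le_trans _ x0) // ltrN10.
by have /andP[] := ceil_itv x; rewrite intrD ltrBlDr.
Qed.

(** Recovers job indices from JS, which the algorithm holds as a bare list of processing times. *)
Lemma perm_map_lift (T1 : eqType) (T2 : eqType) (y0 : T2) (f : T2 -> T1) s t :
  perm_eq s (map f t) -> exists2 t', perm_eq t' t & s = map f t'.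
Proof.
move=> /(perm_iotaP (f y0))[Is pIs ->]; rewrite size_map in pIs.
exists (map (nth y0 t) Is).
  by rewrite -[X in perm_eq _ X](mkseq_nth y0 t) perm_map.
rewrite -map_comp; apply/eq_in_map => i; rewrite (perm_mem pIs) mem_iota add0n /=.
by move=> lt_i; rewrite (nth_map y0).
Qed.

Lemma perm_groups (R : realType) (s : seq R) (zs : seq int) :
  uniq zs ->
  perm_eq (flatten [seq rev (group s z) | z <- zs]) [seq x <- s | clog2 x \in zs].
Proof.
elim: zs => [_|z zs IH] /=.
  by rewrite (eq_filter (a2 := pred0)) ?filter_pred0.
case/andP=> zzs /IH{}IH; rewrite perm_sym.
rewrite -(perm_filterC (fun x => clog2 x == z)) perm_cat //.
  rewrite -filter_predI perm_sym perm_rev /group.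
  rewrite (eq_filter (a2 := fun x => clog2 x == z)) // => x /=.
  by rewrite inE; case: eqP.
rewrite perm_sym; apply: (perm_trans IH).
rewrite -filter_predI (eq_filter (a2 := fun x => clog2 x \in zs)) // => x /=.
by rewrite inE; case: eqP => [->|//]; rewrite (negPf zzs).
Qed.

(** Here [zL] is q0 + k_L + 1, and [zL = q] stands for k_L = -1. Groups above it have fewer than N0
    jobs, so their stored lists are complete. *)
Lemma heavy_keyP (R : realType) (prm : params R) (s : seq R) (zs : seq int) (q : int) :
  pairwise <%R zs -> (forall z, z \in zs -> q < z) ->
  exists zL, [/\
    result (heavy_key prm (map (quad_of (N0 prm) s) zs) (2 ^ q)) = 2 ^ zL, q <= zL,
    zL = q \/ zL \in zs /\ (N0 prm <= size (group s zL))%N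
    & forall z, z \in zs -> zL < z -> (size (group s z) < N0 prm)%N].
Proof.
elim: zs q => [|z zs IH] q /=; first by exists q; split=> //; left.
case/andP=> /allP lt_z pw lt_q; have qz : q < z by apply: lt_q; rewrite mem_head.
have lt_q' y : y \in zs -> q < y by move=> ys; apply: lt_q; rewrite inE ys orbT.
case: leqP => [heavy|light] /=.
  have [zL [-> le_z alt lightL]] := IH z pw lt_z; exists zL; split=> //.
  - exact: le_trans (ltW qz) le_z.
  - right; case: alt => [->|[zLs ?]]; first by rewrite mem_head.
    by rewrite inE zLs orbT.
  - by move=> y; rewrite inE => /orP[/eqP->|/lightL//]; rewrite ltNge le_z.
have [zL [-> le_q alt lightL]] := IH q pw lt_q'; exists zL; split=> //.
- by case: alt => [->|[zLs ?]]; [left | right; rewrite inE zLs orbT].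
- by move=> y; rewrite inE => /orP[/eqP->//|]; apply: lightL.
Qed.

Section Output.
Variables (R : realType) (m m1 : nat) (e0 eps : R) (Ms : m.-tuple (machine R)).
Hypothesis m1_bounds : (1 <= m1 <= m - 1)%N.
Hypothesis e0_bounds : 0 < e0 <= 1.
Hypothesis eps_bounds : 0 < eps < 1.
Hypothesis vM : forall i, valid_machine (tnth Ms i).
Hypothesis rate_e0 :
  forall (i : 'I_m) e, (i < m1)%N -> e \in ratios (tnth Ms i) -> e0 <= e.
Local Notation prm := (Params m m1 e0 eps).
Local Notation A i := (avail (tnth Ms i)).

Lemma m_gt0 : (0 < m)%N.
Proof.
by case/andP: m1_bounds => m10 /(leq_trans m10); rewrite subn_gt0; apply: ltnW.
Qed.

Lemma m1_gt0 : (0 < m1)%N. Proof. by case/andP: m1_bounds. Qed.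
Lemma m1_le_m : (m1 <= m)%N.
Proof. by case/andP: m1_bounds => _ /leq_trans; apply; apply: leq_subr. Qed.
Lemma e0_gt0 : 0 < e0. Proof. by case/andP: e0_bounds. Qed.
Lemma eps_gt0 : 0 < eps. Proof. by case/andP: eps_bounds. Qed.
Lemma mR_gt0 : 0 < m%:R :> R. Proof. by rewrite ltr0n m_gt0. Qed.
Lemma m1R_gt0 : 0 < m1%:R :> R. Proof. by rewrite ltr0n m1_gt0. Qed.
Lemma ratio_gt1 : 1 < 1 + eps / 2.
Proof. by rewrite ltrDl divr_gt0 ?eps_gt0. Qed.
Lemma ratio_gt0 : 0 < 1 + eps / 2. Proof. exact: lt_trans ltr01 ratio_gt1. Qed.

Lemma N0_ge : 4 * m%:R * (m + m1 - 1)%N%:R <= (N0 prm)%:R * (eps * e0 * m1%:R).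
Proof.
rewrite -ler_pdivrMr; last by rewrite !mulr_gt0 ?eps_gt0 ?e0_gt0 ?m1R_gt0.
apply: le_trans (nceil_ge _); rewrite /=.
have H1 := lt0r_neq0 eps_gt0; have H2 := lt0r_neq0 e0_gt0; have H3 := lt0r_neq0 m1R_gt0.
rewrite le_eqVlt; apply/orP; left; apply/eqP; field.
by rewrite H1 H2 H3.
Qed.

Lemma N0_pos : (0 < N0 prm)%N.
Proof.
rewrite lt0n; apply/eqP => N00; have := N0_ge; rewrite N00 mul0r.
rewrite leNgt !mulr_gt0 ?mR_gt0 // ltr0n.
by move: m1_bounds; lia.
Qed.

Lemma gamma0_ge : 2 * (m + m1 - 1)%N%:R <= 2 ^+ gamma0 prm * (eps * e0 * m1%:R) :> R.
Proof.
rewrite -ler_pdivrMr; last by rewrite !mulr_gt0 ?eps_gt0 ?e0_gt0 ?m1R_gt0.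
apply: (@le_trans _ _ (2 ^ gamma0 prm)%N%:R); last by rewrite natrX.
rewrite /gamma0; set x := (X in nceil X).
apply: (@le_trans _ _ (nceil x)%:R); last by rewrite ler_nat up_logP.
apply: le_trans (nceil_ge x); rewrite /x /=.
have H1 := lt0r_neq0 eps_gt0; have H2 := lt0r_neq0 e0_gt0; have H3 := lt0r_neq0 m1R_gt0.
rewrite le_eqVlt; apply/orP; left; apply/eqP; field.
by rewrite H1 H2 H3.
Qed.

Lemma search_depth_ge :
  m%:R / e0 <= (1 + eps / 2) ^+ (2 ^ search_depth prm).-1.
Proof.
have me0 : 0 < m%:R / e0 by rewrite divr_gt0 ?mR_gt0 ?e0_gt0.
rewrite -ler_ln ?posrE ?exprn_gt0 ?ratio_gt0 // lnXn ?ratio_gt0 // -[leRHS]mulr_natl.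
rewrite -ler_pdivrMr ?ln_gt0 ?ratio_gt1 //.
set x := (X in X <= _); apply: le_trans (nceil_ge x) _; rewrite ler_nat.
have := up_logP (nceil x).+1 (isT : (1 < 2)%N).
rewrite -[up_log _ _]/(search_depth prm); lia.
Qed.

(** Conditions (a) and (b) at time t for the large jobs J placed by f. *)
Definition fits (T : eqType) (J : seq T) (w : T -> R) (P : R) (f : T -> nat) (t : R)
    : bool :=
  [forall i : 'I_m, \sum_(j <- J | f j == i) w j <= A i t] && (P <= \sum_(i < m) A i t).

Lemma fits_le (T : eqType) (J : seq T) w P f (t t' : R) :
  t <= t' -> fits J w P f t -> fits J w P f t'.
Proof.
move=> tt' /andP[/forallP Hi HP]; apply/andP; split.
  by apply/forallP => i; apply: le_trans (Hi i) _; rewrite le_avail.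
by apply: le_trans HP _; apply: ler_sum => i _; rewrite le_avail.
Qed.

Lemma fits_first (T : eqType) (J : seq T) (w : T -> R) P (t : R) :
  0 <= t -> P <= e0 * t -> \sum_(j <- J) w j <= P -> fits J w P (fun=> 0%N) t.
Proof.
move=> t0 Pt le_P; pose i0 := Ordinal m_gt0.
have P_le : P <= A i0 t.
  have := @avail_lip_le _ _ e0 0 t (vM i0) (fun r => @rate_e0 i0 r m1_gt0) t0.
  by rewrite avail0 // !subr0; apply: le_trans.
have A0 i : 0 <= A i t by rewrite -(avail0 (vM i)) le_avail.
apply/andP; split.
  apply/forallP => i; case: (eqVneq 0%N i).
    move=> i_0.
    by apply: le_trans le_P (le_trans P_le _); rewrite (_ : i = i0) //; apply: val_inj.
  by move=> _; rewrite big_pred0_eq.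
by apply: le_trans P_le _; rewrite (bigD1 i0) //= lerDl sumr_ge0.
Qed.

Section Search.
Variables (T : eqType) (J : seq T) (w : T -> R) (P : R).
Hypothesis P_gt0 : 0 < P.
Local Notation g := (1 + eps / 2).
Local Notation h := (search_depth prm).
Local Notation tbs := (map (@machine_table R) Ms).
Local Notation gs := [seq g ^+ (2 ^ i) | i <- rev (iota 0 h)].
Local Notation asg f := (rev [seq (f j, w j) | j <- J]).
Local Notation top := (P / m%:R * g ^+ (2 ^ h).-1).

Lemma search_bottom (f : T -> nat) : ~~ fits J w P f (P / m%:R / g).
Proof.
have t0 : 0 < P / m%:R / g by rewrite !divr_gt0 ?mR_gt0 ?ratio_gt0.
rewrite /fits negb_and -ltNge; apply/orP; right.
apply: (@le_lt_trans _ _ (\sum_(i < m) (P / m%:R / g))).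
  by apply: ler_sum => i _; rewrite avail_le // ltW.
rewrite sumr_const card_ord -[ltLHS]mulr_natl mulrA [m%:R * _]mulrC.
rewrite divfK ?lt0r_neq0 ?mR_gt0 // ltr_pdivrMr ?ratio_gt0 //.
by rewrite ltr_pMr // ratio_gt1.
Qed.

(** Failure at t / g is what later yields t <= g T. When the search finds nothing, the last point
    tested is [top], so failure there is known. *)
Lemma try_assignmentP (f : T -> nat) :
  match result (try_assignment prm tbs P gs (asg f) None) with
  | Some t => [/\ 0 < t, fits J w P f t, ~~ fits J w P f (t / g) & t <= top]
  | None => ~~ fits J w P f top
  end.
Proof.
have g0 := ratio_gt0; have gN0 := lt0r_neq0 g0.
have loadsE : result (loads_of (iota 0 m) (asg f))
    = [seq \sum_(j <- J | f j == i) w j | i <- iota 0 m].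
  rewrite loads_ofE; apply: eq_map => i.
  by rewrite (perm_big _ (permEl (perm_rev _))) /= big_map.
have testE x : 0 <= x ->
    result (test tbs (result (loads_of (iota 0 m) (asg f))) P x 0) = fits J w P f x.
  by move=> x0; rewrite loadsE (test_machinesE (fun i => \sum_(j <- J | f j == i) w j)).
have t0 : 0 < P / m%:R / g by rewrite !divr_gt0 ?mR_gt0.
have [|x [lt_x Ex Fx alt]] := @bsearchP _ tbs
    (result (loads_of (iota 0 m) (asg f))) P g (P / m%:R / g) h.
  by rewrite testE ?search_bottom // ltW.
rewrite /try_assignment [result _]/= Ex.
have tE y : P / m%:R / g * g ^+ y.+1 = P / m%:R * g ^+ y.
  by rewrite exprS mulrA divfK.
have t1 y : 0 < P / m%:R / g * g ^+ y by rewrite mulr_gt0 ?exprn_gt0.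
rewrite -mulrA -exprSr testE ?(ltW (t1 _)) //.
rewrite testE ?(ltW (t1 _)) // in Fx; rewrite testE ?(ltW (t1 _)) // in alt.
have le_top : P / m%:R / g * g ^+ x.+1 <= top.
  rewrite tE ler_pM2l ?divr_gt0 ?mR_gt0 // ler_eXn2l ?ratio_gt1 //.
  by move: lt_x; case: (2 ^ h)%N.
case: ifP => [ok|/negbT nok] /=.
  split=> //; rewrite exprSr mulrA mulfK //.
case: alt => [|xE]; first by rewrite (negPf nok).
by rewrite -tE -xE prednK // xE.
Qed.

Lemma best_sound (b : R) :
  result (enum_assignments prm tbs P gs (map w J) [::] None) = Some b -> uniq J ->
  exists f : T -> nat, [/\ forall j, j \in J -> (f j < m)%N, 0 < b & fits J w P f b].
Proof.
move=> + uJ; rewrite enum_assignmentsE => /foldl_omin_some[//|[a]].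
case/(all_asgP _ _ _ _ uJ) => f lt_f ->; rewrite cats0 => E.
by have := try_assignmentP f; rewrite E => -[b0 fb _ _]; exists f.
Qed.

(** If the search for f succeeds, its value divided by g fails and so lies below t. Otherwise t >
    [top], and the assignment of everything to the first machine has a candidate at most [top],
    because [top] reaches P/e0. *)
Lemma best_le (t : R) (f : T -> nat) :
  uniq J -> (forall j, 0 <= w j) -> \sum_(j <- J) w j <= P ->
  (forall j, j \in J -> (f j < m)%N) -> 0 <= t -> fits J w P f t ->
  exists b, result (enum_assignments prm tbs P gs (map w J) [::] None) = Some b /\
    b <= (1 + eps / 2) * t.
Proof.
move=> uJ w0 le_P lt_f t0 ft.
have cand (f' : T -> nat) c : (forall j, j \in J -> (f' j < m)%N) ->
    result (try_assignment prm tbs P gs (asg f') None) = Some c ->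
    exists2 b, result (enum_assignments prm tbs P gs (map w J) [::] None) = Some b
      & b <= c.
  move=> lt_f' E; rewrite enum_assignmentsE; apply: foldl_omin_le E.
  by apply/(all_asgP _ _ _ _ uJ); exists f' => //; rewrite cats0.
have g0 := ratio_gt0.
have := try_assignmentP f; case E: (result _) => [c|].
  case=> c0 _ nfits _; have [b Eb le_b] := cand _ _ lt_f E.
  exists b; split=> //; apply: le_trans le_b _; rewrite mulrC -ler_pdivrMr //.
  by apply/ltW; rewrite ltNge; apply: contra nfits => le_t; apply: fits_le ft.
move=> nfits.
have lt_t : top < t by rewrite ltNge; apply: contra nfits => le_t; apply: fits_le ft.
have lt_0 : forall j, j \in J -> (0 < m)%N by move=> *; exact: m_gt0.
have top0 : 0 < top by rewrite mulr_gt0 ?divr_gt0 ?exprn_gt0 ?mR_gt0.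
have := try_assignmentP (fun=> 0%N); case E0: (result _) => [c|].
  case=> _ _ _ le_c; have [b Eb le_b] := cand _ _ lt_0 E0.
  exists b; split=> //; apply: le_trans le_b (le_trans le_c _).
  by rewrite (le_trans (ltW lt_t)) // ler_peMl // ltW // ratio_gt1.
case/negP; apply: fits_first le_P; first exact: ltW.
have H1 := lt0r_neq0 e0_gt0; have H2 := lt0r_neq0 mR_gt0.
have {1}-> : P = e0 * (P / m%:R * (m%:R / e0)) by field; rewrite H1 H2.
rewrite ler_wpM2l ?(ltW e0_gt0) // ler_wpM2l ?search_depth_ge //.
by rewrite divr_ge0 ?ltW // mR_gt0.
Qed.

End Search.
Lemma alg3_outE (p : seq R) (st : state R) (q : int) (zs : seq int) :
  state_ok prm p st q zs ->
  exists zL JS,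
    [/\ perm_eq JS [seq x <- p | zL < clog2 x], q <= zL,
        zL = q \/ (N0 prm <= size (group p zL))%N
      & result (alg3_out prm Ms st)
        = odflt 0 (result (enum_assignments prm (map (@machine_table R) Ms)
            (\sum_(x <- p) x)
            [seq (1 + eps / 2) ^+ (2 ^ i) | i <- rev (iota 0 (search_depth prm))]
            JS [::] None))
          + (nceil ((m - 1)%N%:R / m1%:R : R))%:R * e0^-1 * 2 ^ zL].
Proof.
case=> Eq pw mem_zs Et [Es _].
have gt_q z : z \in zs -> q < z by rewrite mem_zs => /andP[].
have [zL [EkL le_q alt light]] := heavy_keyP prm p pw gt_q.
have uzs := pairwise_uniq_int pw.
exists zL, (result (large_jobs (2 ^ zL) (quads (st_tree st)))); split=> //.
- rewrite Et large_jobsE filter_map -map_comp.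
  rewrite (_ : map _ _ = [seq rev (group p z) | z <- zs & zL < z]).
    apply: perm_trans (perm_groups _ _) _; first exact: filter_uniq.
    rewrite (eq_in_filter (a2 := fun x => zL < clog2 x)) // => x xp.
    rewrite mem_filter mem_zs; case: ltP => //= lt_x.
    by rewrite (le_lt_trans le_q lt_x); apply/hasP; exists x.
  rewrite (eq_filter (a2 := fun z => zL < z)); last by move=> z /=; rewrite lt_exp2z.
  apply/eq_in_map => z; rewrite mem_filter => /andP[lt_z zzs] /=.
  by rewrite ltnW // light.
- by case: alt => [|[]]; [left | right].
rewrite /alg3_out Eq [result _]/= mk_tablesE quads_bt_flatten cats0 totalE squaresE cats0.
rewrite Et EkL; congr (odflt 0 (result (enum_assignments _ _ _ _ _ _ _)) + _).
rewrite Es big_map.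
have := sum_groups p xpredT uzs; rewrite /= => ->.
(* P_(-1) accounts for the jobs of exponent at most q, the groups of the tree for all the others. *)
rewrite [RHS](bigID (fun x => clog2 x <= q)) /=; congr (_ + _).
rewrite big_seq_cond [RHS]big_seq_cond; apply: eq_bigl => x; rewrite mem_zs.
case xp: (x \in p) => //=; rewrite ltNge.
have -> : has (fun y => clog2 y == clog2 x) p by apply/hasP; exists x.
by rewrite andbT.
Qed.

End Output.

(** * Feasibility of the returned value and the approximation factor *)

Section Guarantee.
Variables (R : realType) (m m1 : nat) (e0 eps : R) (Ms : m.-tuple (machine R)).
Hypothesis m1_bounds : (1 <= m1 <= m - 1)%N.
Hypothesis e0_bounds : 0 < e0 <= 1.
Hypothesis eps_bounds : 0 < eps < 1.
Hypothesis vM : forall i, valid_machine (tnth Ms i).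
Hypothesis rate_e0 :
  forall (i : 'I_m) e, (i < m1)%N -> e \in ratios (tnth Ms i) -> e0 <= e.
Local Notation prm := (Params m m1 e0 eps).
Local Notation A i := (avail (tnth Ms i)).
Local Notation c := (nceil ((m - 1)%N%:R / m1%:R : R)).

Lemma overflow_share : (m - 1 <= m1 * c)%N.
Proof.
have m10 := @m1R_gt0 R m m1 m1_bounds.
have := nceil_ge ((m - 1)%N%:R / m1%:R : R); rewrite ler_pdivrMr //.
by rewrite -natrM ler_nat mulnC.
Qed.

Lemma overflow_share_le : (c * m1 <= m + m1 - 1)%N.
Proof.
have m10 := @m1R_gt0 R m m1 m1_bounds.
have := @nceil_lt R ((m - 1)%N%:R / m1%:R).
rewrite divr_ge0 ?ler0n // => /(_ isT).
rewrite -(ltr_pM2r m10) mulrDl divfK ?lt0r_neq0 // mul1r -natrD -natrM ltr_nat.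
by have := m1_le_m m1_bounds; lia.
Qed.

Section Jobs.
Variables (p : seq R).
Hypothesis p_pos : forall x, x \in p -> 0 < x.
Local Notation T := 'I_(size p).
Local Notation w := (fun j : T => nth 0 p j).
Local Notation P := (\sum_(x <- p) x).

Lemma job_gt0 (j : T) : 0 < w j. Proof. by apply: p_pos; rewrite mem_nth. Qed.

Lemma map_w_enum : map w (enum T) = p.
Proof.
have -> : map w (enum T) = map (nth 0 p) (map val (enum T)) by rewrite -map_comp.
by rewrite val_enum_ord map_nth_iota0 // take_size.
Qed.

Lemma sum_w_enum : \sum_(j <- enum T) w j = P.
Proof. by rewrite -(big_map w xpredT id) map_w_enum. Qed.

Lemma sum_enum_cond (Q : pred T) : \sum_(j | Q j) w j = \sum_(j <- enum T | Q j) w j.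
Proof. by rewrite big_enum_cond. Qed.

Lemma repair_overflow (J : seq T) (f : T -> nat) (b K : R) :
  uniq J -> (forall j, j \in J -> (f j < m)%N) -> (forall j, j \notin J -> w j <= K) ->
  0 <= b -> 0 <= K -> fits Ms J w P f b ->
  exists S : schedule R m (size p), feasible Ms S /\
    makespan S <= b + c%:R * e0^-1 * K.
Proof.
move=> uJ lt_f le_K b0 K0 /andP[/forallP fitsi fitsP].
set V := b + _.
have m0 := m_gt0 m1_bounds; have m10 := m1_gt0 m1_bounds; have e00 := e0_gt0 e0_bounds.
have bV : b <= V by rewrite /V lerDl !mulr_ge0 ?ler0n ?invr_ge0 ?(ltW e00).
pose L i := \sum_(j <- J | f j == i) w j.
pose Sm := [seq j <- enum T | j \notin J].
have pJS : perm_eq (enum T) (J ++ Sm).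
  rewrite -(perm_filterC (fun j => j \in J)) perm_cat //.
  apply: uniq_perm => // [|j]; first by rewrite filter_uniq // enum_uniq.
  by rewrite mem_filter mem_enum andbT.
(* Room left by the large jobs: (b) makes each capacity nonnegative, and (a) makes their sum at
   least the total of the small jobs. *)
pose caps := [seq A i b - L i | i <- enum 'I_m].
have sz_caps : size caps = m by rewrite size_map size_enum_ord.
have LJ : \sum_(i < m) L i = \sum_(j <- J) w j.
  rewrite /L (exchange_big_dep xpredT) //= big_seq [RHS]big_seq; apply: eq_bigr => j jJ.
  by rewrite (big_pred1 (Ordinal (lt_f j jJ))).
have [|||||fp [fp_le fp_cnt]] := @packing _ _ w caps Sm.
- by rewrite filter_uniq // enum_uniq.
- by move=> j _; rewrite ltW // job_gt0.
- by move=> a /mapP[i _ ->]; rewrite subr_ge0 fitsi.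
- by rewrite -size_eq0 sz_caps -lt0n.
- rewrite big_map big_enum /= sumrB LJ lerBrDl -big_cat /=.
  by rewrite -(perm_big _ pJS) /= sum_w_enum.
rewrite sz_caps in fp_le fp_cnt.
pose D := [seq j <- Sm | (m <= fp j)%N].
have uD : uniq D by apply/filter_uniq/filter_uniq/enum_uniq.
have szD : (size D <= m1 * c)%N.
  by apply: leq_trans overflow_share; rewrite size_filter -ltnS subn1 prednK.
(* Overflowing jobs go to the first m1 machines by their rank in [D] modulo m1, so each machine
   receives at most c of them. *)
pose F j := if j \in J then f j else if (fp j < m)%N then fp j else (index j D %% m1)%N.
have lt_F j : (F j < m)%N.
  rewrite /F; case: ifP => [/lt_f//|_]; case: ifP => // _.
  by apply: (@leq_trans m1); [rewrite ltn_mod | apply: m1_le_m m1_bounds].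
pose Fo j : 'I_m := Ordinal (lt_F j).
apply: (@schedule_exists _ _ _ p Fo V vM p_pos); first exact: le_trans bV.
move=> i; rewrite (eq_bigl (fun j => F j == i)) => [|j]; last by rewrite -val_eqE.
rewrite sum_enum_cond (perm_big _ pJS) big_cat /=.
have -> : \sum_(j <- J | F j == i) w j = L i.
  by apply: eq_bigl_seq => j jJ; rewrite /F jJ.
rewrite (bigID (fun j => (fp j < m)%N)) /=.
have le1 : \sum_(j <- Sm | (F j == i) && (fp j < m)%N) w j <= A i b - L i.
  have := fp_le i (ltn_ord i); rewrite (nth_map i) ?size_enum_ord // nth_ord_enum.
  apply: le_trans; rewrite le_eqVlt; apply/orP; left; apply/eqP.
  apply: eq_bigl_seq => j; rewrite mem_filter => /andP[/negPf jJ _].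
  rewrite /F jJ; case: ltnP => lt_j; rewrite ?andbT ?andbF //.
  by apply/esym/gtn_eqF/(leq_trans (ltn_ord i)).
have E2 : \sum_(j <- Sm | (F j == i) && ~~ (fp j < m)%N) w j
    = \sum_(j <- D | (index j D %% m1)%N == i) w j.
  rewrite [RHS]big_filter_cond; apply: eq_bigl_seq => j.
  rewrite mem_filter => /andP[/negPf jJ _]; rewrite /F jJ -leqNgt andbC.
  by case: leqP.
have mapD : [seq index j D | j <- D] = iota 0 (size D).
  apply: (@eq_from_nth _ 0%N) => [|k]; rewrite size_map ?size_iota // => lt_k.
  have x0 : T by case: (D) lt_k => //.
  by rewrite (nth_map x0) // index_uniq // nth_iota.
have le2 : \sum_(j <- D | (index j D %% m1)%N == i) w j
    <= K *+ count (fun k => k %% m1 == i)%N (iota 0 (size D)).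
  have -> : K *+ count (fun k => k %% m1 == i)%N (iota 0 (size D))
      = \sum_(j <- D | (index j D %% m1)%N == i) K.
    by rewrite -mapD count_map big_const_seq iter_addr_0.
  rewrite big_seq_cond [leRHS]big_seq_cond.
  apply: ler_sum => j /andP[]; rewrite !mem_filter => /andP[_ /andP[jJ _]] _.
  exact: le_K.
have le3 : K *+ count (fun k => k %% m1 == i)%N (iota 0 (size D)) <= A i V - A i b.
  case: (ltnP i m1) => [lt_i|le_i].
    have lip := @avail_lip_le _ _ e0 b V (vM i) (fun r => @rate_e0 i r lt_i) bV.
    apply: le_trans lip; rewrite /V addrC addKr.
    have -> : e0 * (c%:R * e0^-1 * K) = K *+ c.
      by rewrite -[RHS]mulr_natl; field; rewrite lt0r_neq0.
    rewrite ler_wpMn2l //.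
    exact: count_modn.
  rewrite (@eq_in_count _ _ pred0) ?count_pred0 => [|k _].
    by rewrite mulr0n subr_ge0 le_avail.
  by apply/ltn_eqF/leq_trans/le_i; rewrite ltn_mod.
have -> : A i V = L i + (A i b - L i + (A i V - A i b)) by ring.
by rewrite E2 lerD2l lerD // (le_trans le2 le3).
Qed.

Lemma total_le_capacity (S : schedule R m (size p)) :
  feasible Ms S -> P <= \sum_(i < m) A i (makespan S).
Proof.
move=> fS; rewrite -sum_w_enum big_enum /=.
rewrite (partition_big (s_mach S) xpredT) //=; apply: ler_sum => i _.
exact: le_load_avail (lexx _).
Qed.

Lemma makespan_ge0 (S : schedule R m (size p)) : 0 <= makespan S.
Proof. exact: bigmax_ge_id. Qed.

Lemma le_job_makespan (S : schedule R m (size p)) (x : R) :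
  feasible Ms S -> x \in p -> x <= makespan S.
Proof.
move=> fS /(nthP 0)[k lt_k <-]; pose j : T := Ordinal lt_k.
apply: le_trans (avail_le (vM (s_mach S j)) (makespan_ge0 S)).
apply: le_trans (le_load_avail (s_mach S j) vM p_pos fS (lexx _)).
by rewrite (bigD1 j) //= lerDl sumr_ge0 // => k' _; rewrite ltW ?job_gt0.
Qed.

(** Common end of the two cases for k_L: its premise is what [gamma0_ge] and [N0_ge], stated without
    denominators, deliver. *)
Lemma overflow_le (K T0 : R) :
  0 <= K -> 2 * (m + m1 - 1)%N%:R * K <= T0 * (eps * e0 * m1%:R) ->
  c%:R * e0^-1 * K <= eps / 2 * T0.
Proof.
move=> K0 H; have m10 := @m1R_gt0 R m m1 m1_bounds; have e00 := e0_gt0 e0_bounds.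
have := overflow_share_le; rewrite -(ler_nat R) natrM => le_c.
have H2 : 2 * (c%:R * m1%:R) * K <= T0 * (eps * e0 * m1%:R).
  by apply: le_trans H; rewrite ler_wpM2r // ler_wpM2l.
have H3 : 2 * c%:R * K <= T0 * (eps * e0).
  rewrite -(ler_pM2r m10); apply: le_trans (le_trans H2 _);
  by rewrite le_eqVlt; apply/orP; left; apply/eqP; ring.
have -> : c%:R * e0^-1 * K = 2 * c%:R * K / (2 * e0) by field; rewrite lt0r_neq0.
rewrite ler_pdivrMr ?mulr_gt0 //; apply: le_trans H3 _.
rewrite le_eqVlt; apply/orP; left; apply/eqP.
by field.
Qed.

Theorem alg3_out_correct (st : state R) (q : int) (zs : seq int) :
  p <> [::] -> state_ok prm p st q zs ->
  let V := result (alg3_out prm Ms st) in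
  (exists S : schedule R m (size p), feasible Ms S /\ makespan S <= V) /\
  ((exists2 x, x \in p & (2 : R) ^ (q + (gamma0 prm)%:Z) <= x) ->
   forall S : schedule R m (size p), feasible Ms S -> V <= (1 + eps) * makespan S).
Proof.
move=> p_nil ok.
have [zL [JS [pJS le_q alt ->]]] :=
  alg3_outE Ms ok.
have e00 := e0_gt0 e0_bounds.
have [j0 _] : exists j0 : T, True.
  by case: (p) p_nil => // x s _; exists ord0.
have P0 : 0 < P.
  rewrite -sum_w_enum big_enum (bigD1 j0) //= ltr_pwDl ?job_gt0 // sumr_ge0 //.
  by move=> k _; rewrite ltW ?job_gt0.
have [J pJ JSE] : exists2 J : seq T,
    perm_eq J [seq j <- enum T | zL < clog2 (w j)] & JS = map w J.
  apply: (perm_map_lift j0); apply: perm_trans pJS _.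
  by rewrite -[in X in perm_eq X _]map_w_enum filter_map.
have uJ : uniq J by rewrite (perm_uniq pJ) filter_uniq // enum_uniq.
have memJ j : (j \in J) = (zL < clog2 (w j)).
  by rewrite (perm_mem pJ) mem_filter mem_enum andbT.
have leJP : \sum_(j <- J) w j <= P.
  rewrite -sum_w_enum (perm_big _ pJ) big_filter /= [leLHS]big_mkcond.
  by apply: ler_sum => j _; case: ifP => // _; rewrite ltW ?job_gt0.
have K0 : 0 < (2 : R) ^ zL by rewrite exp2z_gt0.
have w_ge0 j : 0 <= w j by rewrite ltW ?job_gt0.
have lt_0 j : j \in J -> (0 < m)%N by move=> _; apply: m_gt0 m1_bounds.
rewrite JSE; split.
  (* The time P/e0 witnesses that some assignment succeeds, so the default 0 of [odflt] is never
     returned. *)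
  have Pe0 : 0 <= P / e0 by rewrite divr_ge0 ?ltW.
  have [|b [Eb _]] := best_le m1_bounds e0_bounds eps_bounds vM rate_e0 P0 uJ w_ge0 leJP
    lt_0 Pe0.
    by apply: (fits_first m1_bounds vM rate_e0 _ _ leJP) => //; rewrite mulrC divfK ?lt0r_neq0.
  have [f [lt_f b0 fb]] := best_sound m1_bounds eps_bounds vM P0 Eb uJ.
  rewrite Eb /=; apply: repair_overflow fb => //; rewrite ?ltW // => j.
  by rewrite memJ -leNgt clog2_le ?job_gt0.
move=> [x xp le_x] S fS; set T0 := makespan S.
have T00 : 0 <= T0 := makespan_ge0 S.
have P_le := total_le_capacity fS.
have fitS : fits Ms J w P (fun j => s_mach S j) T0.
  apply/andP; split=> //; apply/forallP => i.
  apply: le_trans (le_load_avail i vM p_pos fS (lexx _)).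
  rewrite (perm_big _ pJ) big_filter_cond /= big_enum_cond /=.
  rewrite [leRHS]big_mkcond [leLHS]big_mkcond; apply: ler_sum => j _.
  rewrite -val_eqE /=; case: (_ < _); case: (_ == _) => //=.
have [b [-> le_b]] := best_le m1_bounds e0_bounds eps_bounds vM rate_e0 P0 uJ w_ge0 leJP
  (fun j _ => ltn_ord (s_mach S j)) T00 fitS.
have -> : (1 + eps) * T0 = (1 + eps / 2) * T0 + eps / 2 * T0 by field.
apply: lerD le_b _; apply: overflow_le; first exact: ltW.
have eem0 : 0 < eps * e0 * m1%:R.
  by rewrite !mulr_gt0 ?(eps_gt0 eps_bounds) ?(@m1R_gt0 R m m1 m1_bounds).
case: alt => [->|heavy].
  have := gamma0_ge m1_bounds e0_bounds eps_bounds => H.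
  apply: (@le_trans _ _ (2 ^+ gamma0 prm * (eps * e0 * m1%:R) * 2 ^ q)).
    by rewrite ler_wpM2r // ltW // exp2z_gt0.
  rewrite mulrAC ler_wpM2r ?(ltW eem0) //.
  apply: le_trans (le_job_makespan fS xp); apply: le_trans le_x.
  by rewrite expfzDr ?pnatr_eq0 // mulrC exprnP.
have H := N0_ge m1_bounds e0_bounds eps_bounds.
have mR0 := @mR_gt0 R m m1 m1_bounds.
have heavyP : (N0 prm)%:R * 2 ^ zL <= 2 * P.
  apply: (@le_trans _ _ (\sum_(y <- group p zL) 2 ^ zL)).
    by rewrite big_const_seq count_predT iter_addr_0 mulrC mulr_natr ler_wpMn2l ?ltW.
  rewrite big_distrr /= /group big_filter [leRHS](bigID (fun y => clog2 y == zL)) /=.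
  apply: ler_wpDr.
    by rewrite big_seq_cond sumr_ge0 // => y /andP[/p_pos y0 _]; rewrite mulr_ge0 ?ltW.
  rewrite big_seq_cond [leRHS]big_seq_cond; apply: ler_sum => y /andP[yp /eqP <-].
  by rewrite ltW // exp2_clog2_lt // p_pos.
have PmT : P <= m%:R * T0.
  apply: le_trans P_le _; rewrite mulr_natl -[m in _ *+ m]card_ord -sumr_const.
  by apply: ler_sum => i _; apply: avail_le.
(* Multiplying by 2m matches the factor 4m in [N0_ge] with N0 K <= 2P <= 2m T0. *)
rewrite -(ler_pM2l (_ : 0 < 2 * m%:R)); last by rewrite mulr_gt0.
apply: (@le_trans _ _ ((N0 prm)%:R * (eps * e0 * m1%:R) * 2 ^ zL)).
  apply: le_trans (ler_wpM2r (ltW K0) H).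
  by rewrite le_eqVlt; apply/orP; left; apply/eqP; ring.
rewrite [leLHS]mulrAC [leRHS]mulrA ler_wpM2r ?(ltW eem0) //.
by apply: le_trans heavyP _; rewrite -mulrA ler_pM2l.
Qed.

End Jobs.
End Guarantee.

(** * Running time and workspace *)

Lemma size_bt_purge (R : realType) f (bnd : R) t acc :
  (size (quads (result (bt_purge f bnd t acc)).1) <= size (quads t))%N.
Proof.
elim: f t acc => //= f IH t acc; have := quads_bt_del_min t.
case: (result _) => [[x u]|] //= Et; case: ifP => //= _.
by rewrite Et /= (leq_trans (IH _ _)).
Qed.

Lemma rebase_cost (R : realType) (prm : params R) (st : state R) (p : R) :
  let k := size (quads (st_tree st)) in
  (time (rebase prm st p) <= k.+1 * (2 * k + 4) + 6 * k + 9)%N /\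
  (peak (rebase prm st p) <= 16 * k + 17)%N.
Proof.
move=> k; rewrite /rebase -/k.
(* The tree operations become opaque functions known only by their costs, so simplification unfolds
   the sequencing and not their bodies. *)
move: (@bt_purge R k.+1) (@bt_purge_cost R k.+1) (@size_bt_purge R k.+1) => purge Hc Hs.
move: (@bt_put R) (@bt_put_cost R) => put Hp /=.
set bnd := (2 ^ _ : R); have [] := Hc bnd (st_tree st) (st_small st).
have := Hs bnd (st_tree st) (st_small st).
rewrite -/k; move: (purge _ _ _) => [r tr pr] /= le_r ? ?.
set a := Quad _ _ _ _; have [] := Hp a r.1.
by move: (put a r.1) => [t' tt pt] /= ? ?; split; lia.
Qed.

Lemma alg3_step_cost (R : realType) (prm : params R) (st : state R) (p : R) :
  let k := size (quads (st_tree st)) in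
  (time (alg3_step prm st p) <= k.+1 * (2 * k + 4) + 12 * k + 30)%N /\
  (peak (alg3_step prm st p) <= 16 * k + 17)%N.
Proof.
move=> k; have [TR KR] := rebase_cost prm st p; rewrite -/k in TR KR.
rewrite /alg3_step; case: (st_q st) => [q|]; last by split; lia.
move: (@bt_find R) (@bt_find_cost R) (@bt_put R) (@bt_put_cost R) => find Hf put Hp.
move: (rebase prm st p) TR KR => [str tr pr] /= TR KR.
set x := (2 ^ _ : R).
have [] := Hf x (st_tree st); rewrite -/k.
move: (find x _) => [o tf pf] /= TF KF; rewrite /frame_words.
case: o => [a|] /=.
  set b := Quad _ _ _ _; have [] := Hp b (st_tree st); rewrite -/k.
  by move: (put b _) => [t' tp pp] /= ? ?; split; lia.
case: ifP => _ /=; first by split; lia.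
case: ifP => _ /=; last by split; lia.
set b := Quad _ _ _ _; have [] := Hp b (st_tree st); rewrite -/k.
by move: (put b _) => [t' tp pp] /= ? ?; split; lia.
Qed.

Lemma mk_table_cost (R : realType) (T A e : R) s :
  (time (mk_table T A e s) <= 5 * size s + 1)%N /\
  (peak (mk_table T A e s) <= 16 * size s + 1)%N.
Proof.
elim: s T A e => [|[b e'] s IH] T A e //=.
by have [? ?] := IH b (A + (b - T) * e) e'; rewrite /frame_words; split; lia.
Qed.

Lemma mk_tables_cost (R : realType) (Ms : seq (machine R)) :
  let n := (\sum_(M <- Ms) n_intervals M)%N in
  (time (mk_tables Ms) <= 5 * n + 3 * size Ms + 1)%N /\
  (peak (mk_tables Ms) <= 16 * (n + size Ms) + 1)%N.
Proof.
elim: Ms => [|M Ms [IHt IHp]] /=; first by rewrite big_nil.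
rewrite big_cons; have [Tt Tp] := mk_table_cost 0 0 (ratio1 M) (later M).
have nE : n_intervals M = (size (later M)).+1 by rewrite /n_intervals /= size_map.
by rewrite /frame_words; split; lia.
Qed.

Lemma total_cost (R : realType) (qs : seq (quad R)) acc :
  time (Defs.total qs acc) = (size qs).+1 /\ peak (Defs.total qs acc) = 1%N.
Proof. by elim: qs acc => //= a qs IH acc; have [-> ->] := IH (acc + tot a). Qed.

Lemma heavy_key_cost (R : realType) (prm : params R) qs dflt :
  time (heavy_key prm qs dflt) = (size qs).+1 /\ peak (heavy_key prm qs dflt) = 1%N.
Proof.
by elim: qs dflt => //= a qs IH d; have [-> ->] := IH (if (N0 prm <= cnt a)%N then key a else d).
Qed.

Lemma append_cost (A : Type) (s1 s2 : seq A) :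
  (time (append s1 s2) <= 2 * size s1 + 1)%N /\
  (peak (append s1 s2) <= 16 * size s1 + 1)%N.
Proof. by elim: s1 => //= x s1 [? ?]; rewrite /frame_words; split; lia. Qed.

Lemma large_jobs_cost (R : realType) (kL : R) (qs : seq (quad R)) :
  let n := (\sum_(a <- qs) size (jobs a))%N in
  [/\ (time (large_jobs kL qs) <= 2 * n + 4 * size qs + 1)%N,
      (peak (large_jobs kL qs) <= 16 * (n + size qs) + 1)%N
    & (size (result (large_jobs kL qs)) <= n)%N].
Proof.
elim: qs => [|a qs [IHt IHp IHs]] /=; first by rewrite big_nil.
rewrite big_cons; case: ifP => _ /=; last by rewrite /frame_words; split; lia.
have [? ?] := append_cost (jobs a) (result (large_jobs kL qs)).
by rewrite appendE size_cat /frame_words; split; lia.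
Qed.

Lemma squares_cost (R : realType) h (g : R) acc :
  (time (squares h g acc) <= 2 * h)%N /\ (peak (squares h g acc) <= 1)%N.
Proof.
by elim: h g acc => //= h IH g acc; have [? ?] := IH (g * g) (g :: acc); split; lia.
Qed.

Lemma locate_cost (R : realType) f (tb : seq (R * R * R)) lo len t k :
  (len <= 2 ^ k)%N ->
  (time (locate f tb lo len t) <= 6 * k + 2)%N /\ (peak (locate f tb lo len t) <= 1)%N.
Proof.
elim: f lo len k => //= f IH lo len k le_len; case: (leqP len 1) => [_|len1] /=.
  by split; lia.
case: k le_len => [|k]; first by lia.
rewrite expnS => le_len; case: ifP => _ /=.
  have [|? ?] := IH (lo + len./2)%N (len - len./2)%N k; first by lia.
  by split; lia.
have [|? ?] := IH lo len./2 k; first by lia.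
by split; lia.
Qed.

Lemma eval_table_cost (R : realType) (tb : seq (R * R * R)) t :
  (time (eval_table tb t) <= 6 * up_log 2 (size tb) + 8)%N /\
  (peak (eval_table tb t) <= 17)%N.
Proof.
have [? ?] := @locate_cost _ (size tb) tb 0 (size tb) t _ (up_logP (size tb) (isT : (1 < 2)%N)).
by rewrite /= /frame_words; split; lia.
Qed.

Definition test_time (R : realType) (tbs : seq (seq (R * R * R))) : nat :=
  (\sum_(tb <- tbs) (6 * up_log 2 (size tb) + 11) + 1)%N.

Lemma test_cost (R : realType) (tbs : seq (seq (R * R * R))) loads (P t acc : R) :
  (time (test tbs loads P t acc) <= test_time tbs)%N /\
  (peak (test tbs loads P t acc) <= 33)%N.
Proof.
rewrite /test_time.
elim: tbs loads acc => [|tb tbs IH] [|ld loads] acc;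
  rewrite ?big_nil ?big_cons ?[test _ _ _ _ _]/= //; first by rewrite /=; split; lia.
have [] := eval_table_cost tb t; move: (eval_table tb t) => [a ta pa] /= ? ?.
have [? ?] := IH loads (acc + a).
by case: ifP => _ /=; rewrite /frame_words; split; lia.
Qed.

Lemma bsearch_cost (R : realType) tbs loads (P : R) gs t :
  (time (bsearch tbs loads P gs t) <= size gs * (test_time tbs + 2) + 1)%N /\
  (peak (bsearch tbs loads P gs t) <= 49)%N.
Proof.
elim: gs t => [|g gs IH] t //=.
have [? ?] := test_cost tbs loads P (t * g) 0.
have [? ?] := IH t; have [? ?] := IH (t * g).
by rewrite mulSn; case: ifP => _; rewrite /frame_words; split; lia.
Qed.

Lemma load_of_cost (R : realType) i (asg : seq (nat * R)) acc :
  time (load_of i asg acc) = (2 * size asg + 1)%N /\ peak (load_of i asg acc) = 1%N.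
Proof.
elim: asg acc => //= [[i' p] asg] IH acc.
by rewrite /=; have [-> ->] := IH (if i' == i then acc + p else acc); split; lia.
Qed.

Lemma loads_of_cost (R : realType) idx (asg : seq (nat * R)) :
  (time (loads_of idx asg) <= size idx * (2 * size asg + 4) + 1)%N /\
  (peak (loads_of idx asg) <= 16 * size idx + 17)%N.
Proof.
elim: idx => //= i idx [? ?]; have [-> ->] := load_of_cost i asg 0.
by rewrite mulSn /frame_words; split; lia.
Qed.

Definition try_time (m j h t : nat) : nat :=
  (m * (2 * j + 4) + h * (t + 2) + t + 12)%N.

Lemma try_assignment_cost (R : realType) (prm : params R) tbs P gs asg best :
  (time (try_assignment prm tbs P gs asg best)
     <= try_time (pm prm) (size asg) (size gs) (test_time tbs))%N /\
  (peak (try_assignment prm tbs P gs asg best) <= 18 * pm prm + 98)%N.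
Proof.
rewrite /try_assignment [time _]/= [peak _]/=.
set loads := result _.
have [T1 K1] := loads_of_cost (iota 0 (pm prm)) asg; rewrite size_iota in T1 K1.
set t0 := _ / _ / _; have [T2 K2] := bsearch_cost tbs loads P gs t0.
set t := _ * _; have [T3 K3] := test_cost tbs loads P t 0.
case: ifP => _; rewrite /try_time /= /frame_words; split; lia.
Qed.

(** The slack 5 closes the recursion: each child costs 2 extra units and the loop 1, so m children
    give at most m (E - 3) + 1, and adding 5 stays within m E exactly when m >= 2. *)
Lemma enum_assignments_cost (R : realType) (prm : params R) tbs P gs js asg best q :
  (1 < pm prm)%N ->
  (try_time (pm prm) (size js + size asg) (size gs) (test_time tbs) <= q)%N ->
  (time (enum_assignments prm tbs P gs js asg best) + 5
     <= pm prm ^ size js * (q + 6))%N /\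
  (peak (enum_assignments prm tbs P gs js asg best)
     <= 16 * size js + 18 * pm prm + 114)%N.
Proof.
move=> m2; elim: js asg best => [|p js IH] asg best le_q.
  have [] := try_assignment_cost prm tbs P gs asg best.
  rewrite add0n in le_q; rewrite [enum_assignments _ _ _ _ _ _ _]/= expn0 mul1n.
  move: (try_assignment _ _ _ _ _ _) => [r tr pr] /= T1 K1.
  by have := leq_trans T1 le_q; rewrite /frame_words; split; lia.
rewrite [enum_assignments _ _ _ _ _ _ _]/=.
set loop := (fix loop (idx : seq nat) (best : option R) := _).
set E := (pm prm ^ size js * (q + 6))%N.
have {}IH i b : let r := enum_assignments prm tbs P gs js ((i, p) :: asg) b in
    (time r + 5 <= E)%N /\ (peak r <= 16 * size js + 18 * pm prm + 114)%N.
  by apply: IH; rewrite /= addnS -addSn.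
suff H idx b : (time (loop idx b) + 3 * size idx <= size idx * E + 1)%N /\
    (peak (loop idx b) <= 16 * (size js).+1 + 18 * pm prm + 114)%N.
  have [] := H (iota 0 (pm prm)) best; rewrite size_iota expnS -mulnA -/E.
  by move: (loop _ _) => r H1 H2; clear -m2 H1 H2; clearbody E; rewrite /=; split; lia.
elim: idx b => [|i idx IHidx] b /=; first by split; lia.
have [] := IH i b; move: (enum_assignments _ _ _ _ _ _ _) => [b' tb pb] /= ? ?.
have [? ?] := IHidx b'.
by rewrite mulSn /frame_words; split; lia.
Qed.

Lemma size_squares (R : realType) h (g : R) acc :
  size (result (squares h g acc)) = (h + size acc)%N.
Proof. by rewrite squaresE size_cat size_map size_rev size_iota. Qed.

Lemma alg3_out_cost (R : realType) (prm : params R) (Ms : seq (machine R))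
    (st : state R) :
  size Ms = pm prm -> (1 < pm prm)%N ->
  let m := pm prm in let h := search_depth prm in
  let n := (\sum_(M <- Ms) n_intervals M)%N in
  let k := size (quads (st_tree st)) in
  let j := (\sum_(a <- quads (st_tree st)) size (jobs a))%N in
  (time (alg3_out prm Ms st)
     <= 5 * n + 3 * m + 10 * k + 2 * j + 2 * h + 30
        + m ^ j * (try_time m j h (test_time (map (@machine_table R) Ms)) + 6))%N /\
  (peak (alg3_out prm Ms st) <= 20 * n + 36 * m + 20 * k + 34 * j + 2 * h + 200)%N.
Proof.
move=> szM m2 m h n k j; rewrite /alg3_out.
case: (st_q st) => [q|]; last by rewrite /=; split; lia.
rewrite !sumnE !big_map -/n -/j -/k -/h szM -/m.
move: (mk_tables Ms) (mk_tablesE Ms) (mk_tables_cost Ms) => [tbs tt tp] /= -> [].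
rewrite -/n szM -/m => Ht Hp.
move: (bt_flatten _ _) (quads_bt_flatten (st_tree st) [::]) (bt_flatten_cost (st_tree st) [::]).
move=> [qs ft fp] /= -> [].
rewrite cats0 -/k => Hft Hfp.
move: (@Defs.total R) (@total_cost R) => tot Htot.
move: (@heavy_key R prm) (@heavy_key_cost R prm) => hvy Hhvy.
move: (@large_jobs R) (@large_jobs_cost R) => lrg Hlrg.
move: (@squares R) (@squares_cost R) (@size_squares R) => sqr Hsqr Ssqr.
move: (@enum_assignments R prm) (@enum_assignments_cost R prm) => enm Henm /=.
have [-> ->] := Htot (quads (st_tree st)) (st_small st).
have [-> ->] := Hhvy (quads (st_tree st)) (2 ^ q).
have [] := Hlrg (result (hvy (quads (st_tree st)) (2 ^ q))) (quads (st_tree st)).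
move: (lrg _ _) => [js jt jp] /=; rewrite -/j -/k => Hjt Hjp Hjs.
have [] := Hsqr h (1 + peps prm / 2) [::]; have := Ssqr h (1 + peps prm / 2) [::].
rewrite -/h; move: (sqr _ _ _) => [gs gt gp] /=; rewrite addn0 => Sg Hgt Hgp.
set P := result (tot _ _).
set tbl := map _ _; set Q := try_time _ _ _ _.
have [|] := Henm tbl P gs js [::] None Q m2.
  rewrite /Q /try_time addn0 Sg.
  have : (m * (2 * size js + 4) <= m * (2 * j + 4))%N.
    by rewrite leq_mul2l; apply/orP; right; lia.
  by rewrite -/m; lia.
move: (enm _ _ _ _ _ _) => [best et ep] /= Het Hep.
have Hpow : (m ^ size js * (Q + 6) <= m ^ j * (Q + 6))%N.
  by rewrite leq_mul2r leq_pexp2l ?orbT // ltnW.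
rewrite -/m in Het Hep; set X := (m ^ j * (Q + 6))%N in Hpow *.
set Y := (m ^ size js * (Q + 6))%N in Het Hpow.
rewrite /frame_words; clearbody X Y; move: (size js) Hjs Hep => szj Hjs Hep.
clear -Ht Hp Hft Hfp Hjt Hjp Hjs Hgt Hgp Het Hep Hpow.
clearbody m h n k j; split; lia.
Qed.

Lemma sa_space_le (X St V : Type) (alg : stream_alg X St V) (B : nat) (s : seq X) :
  (forall s1 s2, s = s1 ++ s2 ->
     let st := sa_state alg s1 in
     (forall x, sa_words alg st + peak (sa_step alg st x) <= B)%N /\
     (s2 = [::] -> sa_words alg st + peak (sa_out alg st) <= B)%N) ->
  (sa_space alg s <= B)%N.
Proof.
move=> H; rewrite /sa_space.
suff S s1 s2 : s = s1 ++ s2 -> (sa_space_from alg (sa_state alg s1) s2 <= B)%N.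
  exact: (S [::] s).
elim: s2 s1 => [|x s2 IH] s1 sE /=; first by have [_ ->] := H _ _ sE.
rewrite geq_max; have [-> _] := H _ _ sE; rewrite andTb -sa_state_rcons.
by apply: IH; rewrite cat_rcons.
Qed.

Section StateSize.
Variables (R : realType) (prm : params R).

(** The exponents in the tree are distinct integers in (q, q + gamma0 + 1]. *)
Lemma state_ok_size (s : seq R) (st : state R) (q : int) (zs : seq int) :
  state_ok prm s st q zs -> (size (quads (st_tree st)) <= (gamma0 prm).+1)%N.
Proof.
case=> _ pw mem_zs -> [_ hi]; rewrite size_map.
rewrite -(size_iota 0 (gamma0 prm).+1) -(size_map (fun i : nat => q + 1 + i%:Z)).
apply: uniq_leq_size; first exact: pairwise_uniq_int.
move=> z; rewrite mem_zs => /andP[lt_qz /hasP[x xs /eqP xz]].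
have := hi x xs; rewrite xz => le_z.
apply/mapP; exists (absz (z - q - 1)%R); last by lia.
by rewrite mem_iota add0n /=; lia.
Qed.

Lemma state_ok_jobs (s : seq R) (st : state R) (q : int) (zs : seq int) :
  state_ok prm s st q zs ->
  (\sum_(a <- quads (st_tree st)) size (jobs a) <= (gamma0 prm).+1 * N0 prm)%N.
Proof.
move=> ok; apply: leq_trans (leq_mul (state_ok_size ok) (leqnn _)).
case: ok => _ _ _ -> _; rewrite size_map big_map mulnC -sum1_size big_distrr /=.
apply: leq_sum => z _; rewrite muln1; case: ifP => //.
by rewrite size_rev.
Qed.

Lemma state_ok_words (s : seq R) (st : state R) (q : int) (zs : seq int) :
  state_ok prm s st q zs ->
  (state_words st <= 4 + (gamma0 prm).+1 * (8 + 2 * N0 prm))%N.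
Proof.
move=> ok; have Hk := state_ok_size ok; have Hj := state_ok_jobs ok.
rewrite /state_words; have := btree_words_le (st_tree st).
rewrite (eq_bigr (fun a => 8 + 2 * size (jobs a))%N) => [|a _]; last first.
  by rewrite /quad_words; lia.
have -> : (\sum_(a <- quads (st_tree st)) (8 + 2 * size (jobs a))
    = 8 * size (quads (st_tree st)) + 2 * \sum_(a <- quads (st_tree st)) size (jobs a))%N.
  by rewrite big_split -sum1_size !big_distrr /=.
by move: Hk Hj; set k := size _; set j := (\sum_(a <- _) _)%N; lia.
Qed.

End StateSize.

(** * Asymptotic bounds *)

Lemma ln2_le1 (R : realType) : ln (2 : R) <= 1.
Proof. by rewrite [2](_ : _ = 1 + 1) // le_ln1Dx // (lt_trans (ltrN10 _)). Qed.

Lemma ln1D_ge (R : realType) (x : R) : 0 <= x -> x / (1 + x) <= ln (1 + x).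
Proof.
move=> x0; have x1 : 0 < 1 + x by rewrite ltr_pwDl.
have -> : ln (1 + x) = - ln (1 + - (x / (1 + x))).
  have -> : 1 + - (x / (1 + x)) = (1 + x)^-1 by field; rewrite lt0r_neq0.
  by rewrite lnV ?posrE // opprK.
rewrite lerNr le_ln1Dx // ltrN2 ltr_pdivrMr // mul1r.
by rewrite ltrDr.
Qed.

Lemma ln2_ge (R : realType) : 2^-1 <= ln (2 : R).
Proof.
by have := @ln1D_ge R 1 ler01; rewrite div1r.
Qed.

Lemma lg_ge1 (R : realType) (x : R) : 1 <= lg x.
Proof. by rewrite /lg le_max lexx. Qed.

Lemma lg_gt0 (R : realType) (x : R) : 0 < lg x.
Proof. exact: lt_le_trans ltr01 (lg_ge1 x). Qed.

Lemma le_lg (R : realType) (x y : R) : 0 < x -> x <= y -> lg x <= lg y.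
Proof.
move=> x0 xy; have y0 := lt_le_trans x0 xy.
rewrite /lg ge_max le_max lexx /= le_max ler_pM2r ?invr_gt0 ?ln2_gt0 //.
by rewrite ler_ln ?posrE // xy orbT.
Qed.

Lemma lg_mul (R : realType) (x y : R) : 0 < x -> 0 < y -> lg (x * y) <= lg x + lg y.
Proof.
move=> x0 y0; rewrite {1}/lg ge_max; apply/andP; split.
  by rewrite (le_trans (lg_ge1 x)) // lerDl ltW // lg_gt0.
by rewrite lnM ?posrE // mulrDl lerD // /lg le_max lexx orbT.
Qed.

Lemma lg_le_double (R : realType) (x : R) : 1 <= x -> lg x <= 2 * x.
Proof.
move=> x1; have x0 := lt_le_trans ltr01 x1.
rewrite /lg ge_max; apply/andP; split; first by rewrite (le_trans x1) // ler_peMl ?ler1n // ltW.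
rewrite ler_pdivrMr ?ln2_gt0 //; apply: le_trans (ltW (ln_sublinear x0)) _.
rewrite mulrAC ler_peMl ?(ltW x0) // -ler_pdivrMl // mulr1.
exact: ln2_ge.
Qed.

Lemma up_log_le (R : realType) (n : nat) (x : R) :
  0 < x -> n%:R <= x -> (up_log 2 n)%:R <= lg x + 1.
Proof.
move=> x0 nx; case: (leqP n 1) => [n1|n1].
  have -> : up_log 2 n = 0%N by apply/eqP; rewrite up_log_eq0 n1 orbT.
  by rewrite addr_ge0 // ltW // lg_gt0.
have lt_n := up_log_gtn (isT : (1 < 2)%N) n1.
have ul0 : (0 < up_log 2 n)%N by rewrite up_log_gt0.
rewrite -(prednK ul0) -natr1 lerD2r /lg le_max; apply/orP; right.
rewrite ler_pdivlMr ?ln2_gt0 // mulr_natl -lnXn // ler_ln ?posrE ?exprn_gt0 //.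
by apply: le_trans nx; rewrite -natrX ler_nat ltnW.
Qed.

Lemma up_logM_le (a b : nat) : (up_log 2 (a * b) <= up_log 2 a + up_log 2 b)%N.
Proof.
by apply: up_log_min => //; rewrite expnD leq_mul // up_logP.
Qed.

Lemma up_log8_le (R : realType) (n : nat) (x : R) :
  1 <= x -> n%:R <= 8 * x -> (up_log 2 n)%:R <= 4 + lg x.
Proof.
move=> x1 nx; have x0 := lt_le_trans ltr01 x1.
apply: le_trans (up_log_le _ nx) _; first by rewrite mulr_gt0.
have -> : 4 + lg x = (3 + lg x) + 1 by ring.
rewrite lerD2r; apply: le_trans (lg_mul _ x0) _ => //.
rewrite lerD2r /lg ge_max ler1n /= ler_pdivrMr ?ln2_gt0 //.
by rewrite -[8]/((2 ^ 3)%N%:R) natrX lnXn // mulr_natl.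
Qed.

Section Bounds.
Variables (R : realType) (m m1 : nat) (e0 eps : R).
Hypothesis m1_bounds : (1 <= m1 <= m - 1)%N.
Hypothesis e0_bounds : 0 < e0 <= 1.
Hypothesis eps_bounds : 0 < eps < 1.
Local Notation prm := (Params m m1 e0 eps).
Local Notation M := (m%:R : R).
Local Notation M1 := (m1%:R : R).
Local Notation X := (M ^+ 2 / (eps * e0 * M1)).
Local Notation Y := (M / (eps * e0 * M1)).
Local Notation W := (1 / eps * lg (M / e0)).

Let e0_pos : 0 < e0 := e0_gt0 e0_bounds.
Let eps_pos : 0 < eps := eps_gt0 eps_bounds.
Let M_pos : 0 < M := @mR_gt0 R m m1 m1_bounds.
Let M1_pos : 0 < M1 := @m1R_gt0 R m m1 m1_bounds.
Let epsN0 : eps != 0 := lt0r_neq0 eps_pos.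
Let e0N0 : e0 != 0 := lt0r_neq0 e0_pos.
Let M1N0 : M1 != 0 := lt0r_neq0 M1_pos.
Let M1_le : M1 <= M. Proof. by rewrite ler_nat (m1_le_m m1_bounds). Qed.
Let den_pos : 0 < eps * e0 * M1. Proof. by rewrite !mulr_gt0. Qed.
Let ee_le1 : eps * e0 <= 1.
Proof.
have [_ e01] := andP e0_bounds; have [_ eps1] := andP eps_bounds.
by rewrite mulr_ile1 // ltW.
Qed.

Lemma Y_ge1 : 1 <= Y.
Proof.
rewrite ler_pdivlMr // mul1r (le_trans _ M1_le) // ler_piMl // ltW //.
Qed.

Lemma XE : X = M * Y. Proof. by rewrite expr2 mulrA. Qed.

Lemma M_le_X : M <= X.
Proof. by rewrite XE ler_peMr ?Y_ge1 // ltW. Qed.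

Lemma M_ge2 : 2 <= M.
Proof.
rewrite ler_nat; have [m10 m1m] := andP m1_bounds.
by have := leq_trans m10 m1m; rewrite ltn_subRL addn0.
Qed.

Lemma M_div_e0_ge1 : 1 <= M / e0.
Proof.
rewrite ler_pdivlMr // mul1r; have [_ e01] := andP e0_bounds.
by apply: le_trans e01 (le_trans _ M_ge2); rewrite ler1n.
Qed.

Lemma X_ge1 : 1 <= X.
Proof. by apply: le_trans M_le_X; apply: le_trans M_ge2; rewrite ler1n. Qed.

Lemma sum_le_2M : (m + m1 - 1)%N%:R <= 2 * M.
Proof.
rewrite -natrM ler_nat (leq_trans (leq_subr _ _)) // mul2n -addnn leq_add2l.
exact: m1_le_m m1_bounds.
Qed.

Lemma gamma0_le : (gamma0 prm).+1%:R <= 6 * lg Y.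
Proof.
have Y1 := Y_ge1; have Y0 := lt_le_trans ltr01 Y1; have L1 := lg_ge1 Y.
have : (gamma0 prm)%:R <= 4 + lg Y.
  apply: up_log8_le => //; rewrite /=; set x := (X in nceil X).
  have xE : x = 2 * (m + m1 - 1)%N%:R / (eps * e0 * M1).
    by rewrite /x; field; rewrite epsN0 e0N0 M1N0.
  have x0 : 0 <= x by rewrite xE divr_ge0 ?mulr_ge0 ?ler0n // ltW.
  have x4 : x <= 4 * Y.
    rewrite xE mulrA ler_pM2r ?invr_gt0 //; have := sum_le_2M; lra.
  have := nceil_lt x0; lra.
rewrite -natr1; lra.
Qed.

Lemma N0_le : (N0 prm)%:R <= 9 * X.
Proof.
have X1 := X_ge1; rewrite /N0 /=; set x := (X in nceil X).
have xE : x = 4 * (M * (m + m1 - 1)%N%:R) / (eps * e0 * M1).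
  by rewrite /x; field; rewrite epsN0 e0N0 M1N0.
have x0 : 0 <= x by rewrite xE divr_ge0 ?mulr_ge0 ?ler0n // ltW.
have x8 : x <= 8 * X.
  rewrite xE [leRHS]mulrA ler_pM2r ?invr_gt0 //.
  have := ler_wpM2l (ltW M_pos) sum_le_2M; rewrite expr2; lra.
have := nceil_lt x0; lra.
Qed.

Lemma W_ge1 : 1 <= W.
Proof.
have [_ eps1] := andP eps_bounds.
rewrite div1r ler_pdivlMl // mulr1; apply: le_trans (lg_ge1 _); exact: ltW.
Qed.

Lemma search_depth_le : (search_depth prm)%:R <= 5 * lg W.
Proof.
have W1 := W_ge1; have L1 := lg_ge1 W; have [_ eps1] := andP eps_bounds.
have [_ e01] := andP e0_bounds.
have : (search_depth prm)%:R <= 4 + lg W; last by lra.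
apply: up_log8_le => //; rewrite /=; set z := (X in nceil X).
have me1 := M_div_e0_ge1.
have g0 : 0 < ln (1 + eps / 2) by rewrite ln_gt0 // ltrDl divr_gt0.
have z0 : 0 <= z by rewrite divr_ge0 ?(ltW g0) ?ln_ge0.
have lg_ge : ln (M / e0) <= lg (M / e0).
  rewrite /lg le_max; apply/orP; right; rewrite ler_pdivlMr ?ln2_gt0 //.
  by rewrite ler_piMr ?ln2_le1 // ln_ge0.
(* From x / (1 + x) <= ln (1 + x) at x = eps/2; the loss from 1/2 to 1/3 uses eps < 1. *)
have g_ge : eps / 3 <= ln (1 + eps / 2).
  apply: le_trans (ln1D_ge _); last by rewrite divr_ge0 // ltW.
  rewrite ler_pdivlMr; last by rewrite ltr_pwDl // divr_ge0 // ltW.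
  have : eps * eps <= eps by rewrite ler_piMr // ltW.
  lra.
have z3 : z <= 3 * W.
  rewrite /z ler_pdivrMr //; apply: le_trans lg_ge _.
  have {1}-> : lg (M / e0) = 3 * W * (eps / 3) by field; rewrite lt0r_neq0.
  by rewrite ler_wpM2l // mulr_ge0 // (le_trans ler01).
have := nceil_lt z0; rewrite -natr1; lra.
Qed.

(** Lets the list of squares, of length O(lg W), disappear into the space bound. *)
Lemma lgW_le : lg W <= 4 * X.
Proof.
have [_ e01] := andP e0_bounds.
have me1 := M_div_e0_ge1.
apply: le_trans (lg_le_double W_ge1) _.
have H : W <= 2 * (M / (eps * e0)).
  have -> : 2 * (M / (eps * e0)) = 1 / eps * (2 * (M / e0)) by field; rewrite !lt0r_neq0.
  by rewrite ler_wpM2l ?lg_le_double // divr_ge0 // ltW.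
have H2 : M / (eps * e0) <= X.
  have -> : X = M / (eps * e0) * (M / M1) by field; rewrite !lt0r_neq0.
  have MM1 : 1 <= M / M1 by rewrite ler_pdivlMr // mul1r.
  by rewrite ler_peMr // ltW // divr_gt0 // mulr_gt0.
lra.
Qed.

Lemma lgY_le : lg Y <= lg (M / (eps * e0)).
Proof.
apply: le_lg; first by rewrite divr_gt0.
rewrite ler_pM2l // lef_pV2 ?posrE ?mulr_gt0 //.
by rewrite ler_peMr ?ler1n ?(m1_gt0 m1_bounds) // mulr_ge0 ?ltW.
Qed.

Lemma stored_jobs_le : ((gamma0 prm).+1 * N0 prm)%N%:R <= 54 * (X * lg Y).
Proof.
rewrite natrM; have -> : 54 * (X * lg Y) = 6 * lg Y * (9 * X) by ring.
by rewrite ler_pM ?ler0n ?gamma0_le ?N0_le.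
Qed.

End Bounds.

(** Here PJ is m^J, D bounds the search depth up to a constant, L is the sum of the logarithms of
    the k_i, and Z stands for t_1. The cost of one assignment is O(J D L), and J <= PJ turns PJ
    times this into O(PJ PJ D L). The constant 20000 is generous. *)
Lemma output_time_arith (R : realType) (c0 ra nt n M J h T D L PJ Z t : R) :
  0 <= c0 -> 0 <= ra -> 0 <= nt -> n <= c0 * (nt + M) -> 0 <= M -> M <= L -> 2 <= L ->
  1 <= J -> J <= PJ -> 0 <= h -> h <= 5 * D -> 1 <= D -> 0 <= T ->
  T <= (6 * ra + 24) * L -> PJ * PJ * (D * L) <= Z ->
  t <= 5 * n + 3 * M + 12 * J + 2 * h + 30
       + PJ * (M * (2 * J + 4) + h * (T + 2) + T + 18) ->
  t <= 20000 * (c0 + ra + 1) * (nt + Z).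
Proof.
move=> c00 ra0 nt0 n_le M0 ML L2 J1 JPJ h0 hD D1 T0 TL UZ; move/le_trans; apply.
set F := D * L in UZ *; set c1 := 6 * ra + 24 in TL.
have c10 : 0 <= c1 by rewrite /c1; lra.
have L0 : 0 <= L by lra.
have PJ1 : 1 <= PJ by apply: le_trans JPJ.
have LF : L <= F by rewrite /F ler_peMl.
have F0 : 0 <= F by apply: le_trans LF.
have DF : D <= F by rewrite /F ler_peMr //; lra.
have FS : F <= J * F by rewrite ler_peMl.
have FU : J * F <= PJ * F by rewrite ler_wpM2r.
have UU : PJ * F <= PJ * PJ * F by rewrite ler_wpM2r // ler_peMr //; lra.
have PJU : PJ <= PJ * PJ * F.
  by rewrite -mulrA ler_peMr ?mulr_ege1 //; lra.
have b1 : M * (2 * J + 4) <= 6 * (J * F).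
  apply: (@le_trans _ _ (F * (6 * J))); last by lra.
  by apply: ler_pM; lra.
have b2 : h * (T + 2) <= 5 * (c1 + 1) * (J * F).
  apply: (@le_trans _ _ (5 * D * ((c1 + 1) * L))); first by apply: ler_pM; lra.
  have -> : 5 * D * ((c1 + 1) * L) = 5 * (c1 + 1) * F by rewrite /F; ring.
  by rewrite ler_wpM2l //; lra.
have b3 : T <= c1 * (J * F).
  by apply: le_trans TL _; rewrite ler_wpM2l // (le_trans LF).
have b4 : M * (2 * J + 4) + h * (T + 2) + T + 18 <= (6 * c1 + 29) * (PJ * F).
  have : (6 * c1 + 29) * (J * F) <= (6 * c1 + 29) * (PJ * F) by rewrite ler_wpM2l //; lra.
  lra.
have b5 : PJ * (M * (2 * J + 4) + h * (T + 2) + T + 18) <= (6 * c1 + 29) * Z.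
  apply: (@le_trans _ _ ((6 * c1 + 29) * (PJ * PJ * F))).
    have -> : (6 * c1 + 29) * (PJ * PJ * F) = PJ * ((6 * c1 + 29) * (PJ * F)) by ring.
    by rewrite ler_wpM2l //; lra.
  by rewrite ler_wpM2l //; lra.
have Z1 : M <= Z by lra.
have c0M : c0 * M <= c0 * Z by rewrite ler_wpM2l.
have Z0 : 0 <= Z by lra.
have c0nt : 0 <= c0 * nt by rewrite mulr_ge0.
have rant : 0 <= ra * nt by rewrite mulr_ge0.
have c0Z : 0 <= c0 * Z by rewrite mulr_ge0.
have raZ : 0 <= ra * Z by rewrite mulr_ge0.
rewrite /c1 in b5; lra.
Qed.

Lemma space_arith (R : realType) (c0 ra nt n M J h D X XL s : R) :
  0 <= c0 -> 0 <= ra -> 0 <= nt -> n <= c0 * (nt + M) -> M <= X -> 0 <= M ->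
  J <= 54 * XL -> h <= 5 * D -> D <= 4 * X -> X <= XL ->
  s <= 22 * n + 38 * M + 268 * J + 2 * h ->
  s <= 20000 * (c0 + ra + 1) * (nt + XL).
Proof.
move=> c00 ra0 nt0 n_le MX M0 JX hD DX XXL; move/le_trans; apply.
have c0M : c0 * M <= c0 * XL by rewrite ler_wpM2l // (le_trans MX).
have XL0 : 0 <= XL by lra.
have c0nt : 0 <= c0 * nt by rewrite mulr_ge0.
have rant : 0 <= ra * nt by rewrite mulr_ge0.
have c0Z : 0 <= c0 * XL by rewrite mulr_ge0.
have raZ : 0 <= ra * XL by rewrite mulr_ge0.
lra.
Qed.

(** The summand m accounts for machines with k_i = 0, which still have an interval; it is absorbed
    later by the other terms. *)
Lemma intervals_le (R : realType) (m C0 : nat) (Ms : m.-tuple (machine R))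
    (ks : m.-tuple nat) :
  (forall i, (n_intervals (tnth Ms i) <= C0 * maxn 1 (tnth ks i))%N) ->
  (\sum_(M <- Ms) n_intervals M <= C0 * (\sum_(k <- ks) k + m))%N.
Proof.
move=> H; rewrite !big_tuple.
have -> : (\sum_(i < m) tnth ks i + m = \sum_(i < m) (tnth ks i + 1))%N.
  by rewrite big_split /= sum1_card card_ord.
rewrite big_distrr /=.
by apply: leq_sum => i _; apply: leq_trans (H i) _; rewrite leq_mul2l; lia.
Qed.

Lemma sum_lg_ge (R : realType) (m : nat) (ks : m.-tuple nat) :
  m%:R <= \sum_(k <- ks) lg (k%:R : R).
Proof.
rewrite big_tuple; have -> : (m%:R : R) = \sum_(i < m) 1 by rewrite sumr_const card_ord.
by apply: ler_sum => i _; apply: lg_ge1.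
Qed.

Lemma up_log_lg (R : realType) (k : nat) :
  (up_log 2 (maxn 1 k))%:R <= 2 * lg (k%:R : R).
Proof.
have L1 := lg_ge1 (k%:R : R); case: k L1 => [|k] L1.
  by rewrite up_log1 mulr_ge0 // (le_trans ler01).
have : (up_log 2 k.+1)%:R <= lg (k.+1%:R : R) + 1 by apply: up_log_le.
by rewrite (maxn_idPr _) //; lra.
Qed.

Lemma test_time_le (R : realType) (m C0 : nat) (Ms : m.-tuple (machine R))
    (ks : m.-tuple nat) :
  (0 < m)%N ->
  (forall i, (n_intervals (tnth Ms i) <= C0 * maxn 1 (tnth ks i))%N) ->
  (test_time (map (@machine_table R) Ms))%:R
    <= (6 * (up_log 2 C0)%:R + 24) * \sum_(k <- ks) lg (k%:R : R).
Proof.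
move=> m0 H; have := sum_lg_ge R ks; have : (1 : R) <= m%:R by rewrite ler1n.
rewrite /test_time big_map !big_tuple natrD natr_sum => m1 mL.
set a : R := (up_log 2 C0)%:R; have a0 : 0 <= a by rewrite ler0n.
have : \sum_(i < m) ((6 * up_log 2 (size (machine_table (tnth Ms i))) + 11)%N%:R : R)
    <= \sum_(i < m) (6 * a + 23) * lg ((tnth ks i)%:R : R).
  apply: ler_sum => i _; rewrite size_machine_table.
  have : (up_log 2 (n_intervals (tnth Ms i)) <= up_log 2 C0 + up_log 2 (maxn 1 (tnth ks i)))%N.
    exact: leq_trans (leq_up_log 2 (H i)) (up_logM_le _ _).
  rewrite -(ler_nat R) natrD -/a => le_u.
  have le_k := up_log_lg R (tnth ks i); have L1 := lg_ge1 ((tnth ks i)%:R : R).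
  have aL : a <= a * lg ((tnth ks i)%:R : R) by rewrite ler_peMr.
  rewrite natrD natrM; lra.
rewrite -big_distrr /=; lra.
Qed.

Lemma opt_makespan_le (R : realType) (m : nat) (Ms : m.-tuple (machine R)) (p : seq R)
    (S : schedule R m (size p)) :
  feasible Ms S -> opt_makespan Ms p <= makespan S.
Proof.
move=> fS; apply: ge_inf; last by exists S.
by exists 0 => _ [S' _ <-]; apply: makespan_ge0.
Qed.

(** Lower bounds proved against every feasible schedule pass to the infimum, attained or not; [S]
    makes the set nonempty. *)
Lemma le_opt_makespan (R : realType) (m : nat) (Ms : m.-tuple (machine R)) (p : seq R)
    (S : schedule R m (size p)) (v : R) :
  feasible Ms S -> (forall S' : schedule R m (size p), feasible Ms S' -> v <= makespan S') ->
  v <= opt_makespan Ms p.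
Proof.
move=> fS lb; apply: lb_le_inf; first by exists (makespan S); exists S.
by move=> _ [S' fS' <-]; apply: lb.
Qed.

(** * Time and space of the complete run in terms of the number of stored jobs *)

Section Resources.
Variables (R : realType) (m m1 : nat) (e0 eps : R).
Hypothesis m1_bounds : (1 <= m1 <= m - 1)%N.
Hypothesis e0_bounds : 0 < e0 <= 1.
Hypothesis eps_bounds : 0 < eps < 1.
Local Notation prm := (Params m m1 e0 eps).
Local Notation G := (gamma0 prm).+1.
Local Notation J := ((gamma0 prm).+1 * N0 prm)%N.
Variables (Ms : m.-tuple (machine R)) (q_init : option int) (p : seq R).
Hypothesis p_pos : forall x, x \in p -> 0 < x.
Local Notation alg := (alg3 prm q_init Ms).

Lemma prefix_state (s1 s2 : seq R) : p = s1 ++ s2 ->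
  let st := sa_state alg s1 in
  [/\ (size (quads (st_tree st)) <= G)%N,
      (\sum_(a <- quads (st_tree st)) size (jobs a) <= J)%N
    & (state_words st <= 4 + G * (8 + 2 * N0 prm))%N].
Proof.
move=> pE st.
have s1_pos x : x \in s1 -> 0 < x by move=> xs; apply: p_pos; rewrite pE mem_cat xs.
have N0_gt0 := N0_pos m1_bounds e0_bounds eps_bounds.
rewrite /st {st}; case: (alg3_state_ok N0_gt0 q_init Ms s1_pos) => [[-> _]|[q [zs [ok _]]]].
  by rewrite /state_words /= big_nil.
by split; [apply: state_ok_size ok | apply: state_ok_jobs ok | apply: state_ok_words ok].
Qed.

Lemma le_G_J : (G <= J)%N.
Proof. by rewrite leq_pmulr // N0_pos. Qed.

Lemma job_time_le (s : seq R) (x : R) : prefix (rcons s x) p ->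
  (sa_job_time alg s x <= G.+1 * (2 * G + 4) + 12 * G + 30)%N.
Proof.
case/prefixP => s2; rewrite cat_rcons => pE; have [le_k _ _] := prefix_state pE.
have [le_t _] := alg3_step_cost prm (sa_state alg s) x.
apply: leq_trans le_t _; apply: leq_add => //; apply: leq_add; last by rewrite leq_mul2l le_k.
by rewrite leq_mul // leq_add2r leq_mul2l le_k.
Qed.

Lemma m_gt1 : (1 < m)%N.
Proof. by have := M_ge2 R m1_bounds; rewrite ler_nat. Qed.

Local Notation n := (\sum_(M <- Ms) n_intervals M)%N.
Local Notation h := (search_depth prm).

(** With G <= J and 1 <= J, the output phase contributes 20 + 34 + 200 and the state 4 + 8 + 2,
    which sum to 268. *)
Lemma space_le : (sa_space alg p <= 22 * n + 38 * m + 268 * J + 2 * h)%N.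
Proof.
have le_GJ := le_G_J.
apply: sa_space_le => s1 s2 pE st; have [le_k le_j le_w] := prefix_state pE.
have [] := prefix_state pE; rewrite -/st.
set k := size _; set j := (\sum_(a <- _) _)%N; set w := state_words st => {}le_k {}le_j {}le_w.
have J1 : (1 <= J)%N by apply: leq_trans le_GJ.
have le_w' : (w <= 4 + 8 * G + 2 * J)%N.
  by apply: leq_trans le_w _; rewrite mulnDr; lia.
rewrite /= sumnE big_map size_tuple -/w.
have [_ Hout] := alg3_out_cost st (size_tuple Ms : size Ms = pm prm) m_gt1.
rewrite /= -/k -/j in Hout.
split=> [x|_].
  have [_ Hst] := alg3_step_cost prm st x; rewrite -/k in Hst.
  move: (peak _) Hst => pk Hst; move: J le_GJ le_j J1 le_w' => J' le_GJ le_j J1 le_w'.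
  by lia.
move: (peak _) Hout => pk Hout; move: J le_GJ le_j J1 le_w' => J' le_GJ le_j J1 le_w'.
by lia.
Qed.

Lemma output_time_le :
  (time (sa_output alg p)
    <= 5 * n + 3 * m + 12 * J + 2 * h + 30
       + m ^ J * (m * (2 * J + 4)
          + h * (test_time (map (@machine_table R) Ms) + 2)
          + test_time (map (@machine_table R) Ms) + 18))%N.
Proof.
have pE : p = p ++ [::] by rewrite cats0.
have [le_k le_j _] := prefix_state pE.
have [le_t _] := alg3_out_cost (sa_state alg p) (size_tuple Ms : size Ms = pm prm) m_gt1.
rewrite /= in le_t.
apply: leq_trans le_t _; have le_GJ := le_G_J.
move: (size _) (\sum_(a <- _) _)%N le_k le_j => k j le_k le_j.
rewrite /try_time; move: (test_time _) => T.
have le_pow : (m ^ j <= m ^ J)%N by rewrite leq_pexp2l // ltnW // m_gt1.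
apply: leq_add; last first.
  apply: leq_mul => //.
  have : (m * (2 * j + 4) <= m * (2 * J + 4))%N by rewrite leq_mul2l leq_add2r leq_mul2l le_j !orbT.
  by move: (m * _)%N (m * _)%N => a b; lia.
move: J le_GJ le_j {le_pow} => J' le_GJ le_j; lia.
Qed.

End Resources.

(* C0 is the constant of "O(k_i) intervals in total"; C is the constant of the
   space and output-time bounds; c1 is the constant of "O(1) per job", which may
   depend on the fixed parameters m, m1, e0, eps only.  The pass starts with
   q0 = q_init, where None means q0 = -oo (the first job sets q0); only the upper
   bound on V needs a condition when the pass starts with a finite q0. *)
Theorem theorem4 (R : realType) (C0 : nat) :
  exists C : R, 0 < C /\
  forall (m m1 : nat) (e0 eps : R),
    (1 <= m1 <= m - 1)%N -> 0 < e0 <= 1 -> 0 < eps < 1 ->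
  let prm := Params m m1 e0 eps in
  exists c1 : nat,
  forall (Ms : m.-tuple (machine R)) (ks : m.-tuple nat),
    (forall i, valid_machine (tnth Ms i)) ->
    (forall (i : 'I_m) e, (i < m1)%N -> e \in ratios (tnth Ms i) -> e0 <= e) ->
    (forall i, (n_shared (tnth Ms i) <= tnth ks i <= n_intervals (tnth Ms i))%N) ->
    (forall i, (n_intervals (tnth Ms i) <= C0 * maxn 1 (tnth ks i))%N) ->
  forall (q_init : option int) (p : seq R),
    p <> [::] -> (forall x, x \in p -> 0 < x) ->
  let alg := alg3 prm q_init Ms in
  let V := result (sa_output alg p) in
  let ntilde := (\sum_(k <- ks) k)%N in
  (* V bounds the makespan of a feasible schedule *)
  [/\ opt_makespan Ms p <= V /\
        (exists S : schedule R m (size p), feasible Ms S /\ makespan S <= V),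
  (* approximation factor *)
      (if q_init is Some q then
         exists2 x, x \in p & (2 : R) ^ (q + (gamma0 prm)%:Z) <= x
       else True) ->
        V <= (1 + eps) * opt_makespan Ms p,
  (* time per job *)
      forall s x, prefix (rcons s x) p -> (sa_job_time alg s x <= c1)%N,
  (* space *)
      (sa_space alg p)%:R <= space_bound C prm ntilde
  (* time to output *)
    & (time (sa_output alg p))%:R <= C * (ntilde%:R + t1_bound C prm ks)].
Proof.
pose c0 : R := C0%:R; pose ra : R := (up_log 2 C0)%:R.
have c00 : 0 <= c0 by rewrite ler0n.
have ra0 : 0 <= ra by rewrite ler0n.
set C : R := 20000 * (c0 + ra + 1).
(* The exponent in t_1 must cover m^J squared with J <= 54 X lg Y, and 108 = 2 * 54. *)
have C_ge : 108 <= C by rewrite /C; lra.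
exists C; split; first by rewrite /C mulr_gt0 // ltr_wpDl // addr_ge0.
move=> m m1 e0 eps m1_bounds e0_bounds eps_bounds prm.
set G := (gamma0 prm).+1.
exists (G.+1 * (2 * G + 4) + 12 * G + 30)%N.
move=> Ms ks vM rate_e0 shared intervals q_init p p_nil p_pos alg V ntilde.
have N0_gt0 := N0_pos m1_bounds e0_bounds eps_bounds.
have eps0 := eps_gt0 eps_bounds.
have [q [zs [ok src]]] : exists q zs, state_ok prm p (sa_state alg p) q zs /\
    (q_init = Some q \/ exists2 x, x \in p & q = clog2 x - (gamma0 prm)%:Z - 1).
  by case: (alg3_state_ok N0_gt0 q_init Ms p_pos) => // [[_ [_ /p_nil]]].
have [[S [fS S_le]] approx] := alg3_out_correct m1_bounds e0_bounds eps_bounds vM rate_e0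
  p_pos p_nil ok.
pose Lam : R := \sum_(k <- ks) lg k%:R.
have m_pos := mR_gt0 R m1_bounds.
have n_le : (\sum_(M <- Ms) n_intervals M)%N%:R <= c0 * (ntilde%:R + m%:R).
  by rewrite -natrD -natrM ler_nat intervals_le.
have J_le := stored_jobs_le m1_bounds e0_bounds eps_bounds.
have X1 := X_ge1 m1_bounds e0_bounds eps_bounds.
have MX := M_le_X m1_bounds e0_bounds eps_bounds.
have M2 := M_ge2 R m1_bounds.
have h_le := search_depth_le m1_bounds e0_bounds eps_bounds.
split.
- by split; [apply: le_trans (opt_makespan_le fS) S_le | exists S].
(* If q is still the initial value, the job is supplied by the condition on [q_init]. Otherwise the
   job x that set q works, since q + gamma0 = [clog2 x] - 1. *)
- move=> start; have big_job : exists2 x, x \in p & (2 : R) ^ (q + (gamma0 prm)%:Z) <= x.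
    case: src start => [-> //|[x xp ->] _]; exists x => //.
    have -> : clog2 x - (gamma0 prm)%:Z - 1 + (gamma0 prm)%:Z = clog2 x - 1 by rewrite addrAC subrK.
    by rewrite ltW // -clog2_gt ?p_pos // gtrBl.
  rewrite -ler_pdivrMl; last by rewrite addr_gt0.
  apply: (le_opt_makespan fS) => S' fS'.
  by rewrite ler_pdivrMl ?addr_gt0 //; apply: approx.
- by move=> s x; apply: job_time_le.
- rewrite /space_bound /=.
  have lgY := lgY_le m1_bounds e0_bounds eps_bounds.
  have lgY'1 := lg_ge1 (m%:R / (eps * e0)).
  apply: (@space_arith R c0 ra ntilde%:R (\sum_(M <- Ms) n_intervals M)%N%:R m%:R
    (G * N0 prm)%N%:R (search_depth prm)%:R (lg (1 / eps * lg (m%:R / e0)))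
    (m%:R ^+ 2 / (eps * e0 * m1%:R))) => //.
  + apply: le_trans J_le _; rewrite ler_pM2l // ler_wpM2l // (le_trans ler01) //.
  + exact: lgW_le m1_bounds e0_bounds eps_bounds.
  + by rewrite ler_peMr // (le_trans ler01).
  rewrite -!natrM -!natrD ler_nat.
  exact: space_le.
rewrite /t1_bound /=; set E := C * (_ * _); set D := lg (1 / eps * _).
have D1 : 1 <= D := lg_ge1 _.
have J1 : (1 <= G * N0 prm)%N by rewrite muln_gt0 N0_gt0.
have Lam_ge : m%:R <= Lam := sum_lg_ge R ks.
have pow_le : (m ^ (G * N0 prm))%:R * (m ^ (G * N0 prm))%:R <= m%:R `^ E.
  rewrite -natrM -expnD addnn -muln2 natrX -powR_mulrn ?ler0n //.
  apply: ler_powR; first by rewrite ler1n (m_gt0 m1_bounds).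
  rewrite natrM mulrC; apply: le_trans (ler_wpM2l (ler0n _ 2) J_le) _.
  rewrite [leLHS]mulrA /E ler_wpM2r //.
    by rewrite mulr_ge0 ?(le_trans ler01) // lg_ge1.
  by rewrite -natrM.
apply: (@output_time_arith R c0 ra ntilde%:R (\sum_(M <- Ms) n_intervals M)%N%:R m%:R
  (G * N0 prm)%N%:R (search_depth prm)%:R
  (test_time (map (@machine_table R) Ms))%:R D Lam (m ^ (G * N0 prm))%:R) => //.
- exact: le_trans M2 _.
- by rewrite ler1n.
- by rewrite ler_nat ltnW // ltn_expl // (m_gt1 R m1_bounds).
- exact: test_time_le (m_gt0 m1_bounds) intervals.
- rewrite -[leRHS]mulrA ler_wpM2r // mulr_ge0 // (le_trans ler01) //.
  by apply: le_trans Lam_ge; apply: le_trans M2; rewrite ler1n.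
rewrite -!(natrM, natrD) ler_nat.
exact: output_time_le.
Qed.
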